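(* Let $0<r<1$ and let $B_1,\dots,B_m$ be doubly commuting $2\times 2$ complex matrices, each an $\mathbb{A}_r$-contraction on $\mathcal{H}=\mathbb{C}^2$. Then there exist a Hilbert space $\mathcal{K}\supseteq\mathcal{H}$ and commuting $\mathbb{A}_r$-unitaries $U_1,\dots,U_m$ on $\mathcal{K}$ such that $$f(B_1,\dots,B_m)=P_{\mathcal{H}}f(U_1,\dots,U_m)|_{\mathcal{H}}\quad\text{for every } f\in Rat(\overline{\mathbb{A}}_r^m).$$
   Context: $\mathbb{A}_r=\{z: r<|z|<1\}$, $\partial\mathbb{A}_r=\mathbb{T}\cup r\mathbb{T}$, $\mathbb{A}_r^m$ the $m$-fold product. $Rat(X)$ is the algebra of rational functions $p/q$ with $q$ zero-free on $X$, $f(\underline{T})=p(\underline{T})q(\underline{T})^{-1}$. An $\mathbb{A}_r$-contraction is an operator $T$ with $\sigma(T)\subseteq\overline{\mathbb{A}}_r$ and $\|f(T)\|\le\sup_{\overline{\mathbb{A}}_r}|f|$ for all $f\in Rat(\overline{\mathbb{A}}_r)$. An $\mathbb{A}_r$-unitary is a normal operator with spectrum in $\partial\mathbb{A}_r$. A commuting tuple $(A_1,\dots,A_m)$ is doubly commuting if $A_iA_j^*=A_j^*A_i$ for $i\ne j$. $P_{\mathcal{H}}$ is the orthogonal projection onto $\mathcal{H}$. *)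

(* Defs.v *)
From HB Require Import structures.
From mathcomp Require Import all_boot all_order all_algebra.
From mathcomp Require Import complex.
From mathcomp Require Import Rstruct.
From mathcomp Require Import mpoly.
Set Implicit Arguments. Unset Strict Implicit. Unset Printing Implicit Defensive.
Import Order.TTheory GRing.Theory Num.Theory.
Local Open Scope ring_scope.
Local Open Scope complex_scope.

Definition R := Rdefinitions.R.
Definition C := R[i].

Definition in_cl_annulus (r : R) (z : C) : bool := (r%:C <= `|z|) && (`|z| <= 1).
Definition in_bd_annulus (r : R) (z : C) : bool := (`|z| == r%:C) || (`|z| == 1).

Definition ip2 (x y : 'cV[C]_2) : C := \sum_(i < 2) x i 0 * (y i 0)^*.
Definition adjmx (A : 'M[C]_2) : 'M[C]_2 := (map_mx conjc A)^T.
Definition opnorm_le (A : 'M[C]_2) (M : C) : Prop :=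
  forall x : 'cV[C]_2, ip2 (A *m x) (A *m x) <= M ^+ 2 * ip2 x x.
Definition rat_eval_mx (A : 'M[C]_2) (p q : {poly C}) : 'M[C]_2 :=
  horner_mx A p *m invmx (horner_mx A q).

(* A_r-contraction (on C^2): sigma(A) in the closed annulus and
   ||f(A)|| <= sup_{closed annulus} |f| for every f = p/q in Rat(closed annulus).
   "||f(A)|| <= sup |f|" is written: every bound M of |f| on the closed
   annulus bounds ||f(A)||. *)
Definition Ar_contraction_mx (r : R) (A : 'M[C]_2) : Prop :=
  (forall l : C, (A - l%:M) \notin unitmx -> in_cl_annulus r l) /\
  (forall p q : {poly C}, (forall z, in_cl_annulus r z -> q.[z] != 0) ->
     forall M : C, (forall z, in_cl_annulus r z -> `|p.[z] / q.[z]| <= M) ->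
       opnorm_le (rat_eval_mx A p q) M).

Definition doubly_commuting (m : nat) (B : 'I_m -> 'M[C]_2) : Prop :=
  (forall i j, B i *m B j = B j *m B i) /\
  (forall i j, i != j -> B i *m adjmx (B j) = adjmx (B j) *m B i).

Definition mpoly_mx (m : nat) (B : 'I_m -> 'M[C]_2) (p : {mpoly C[m]}) : 'M[C]_2 :=
  \sum_(mm <- msupp p) p@_mm *: \prod_(i < m) B i ^+ mm i.

Definition is_hilbert (K : lmodType C) (ip : K -> K -> C) : Prop :=
  [/\ forall (a : C) (x y z : K), ip (a *: x + y) z = a * ip x z + ip y z,
      forall x y, ip x y = (ip y x)^*,
      forall x, 0 <= ip x x,
      forall x, ip x x = 0 -> x = 0 &
      forall s : nat -> K,
        (forall eps : C, 0 < eps -> exists N : nat, forall n k : nat,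
            (N <= n)%N -> (N <= k)%N -> ip (s n - s k) (s n - s k) < eps) ->
        exists x : K, forall eps : C, 0 < eps -> exists N : nat, forall n : nat,
            (N <= n)%N -> ip (s n - x) (s n - x) < eps].

Definition bounded_op (K : lmodType C) (ip : K -> K -> C) (T : K -> K) : Prop :=
  (forall (a : C) (x y : K), T (a *: x + y) = a *: T x + T y) /\
  exists M : C, forall x, ip (T x) (T x) <= M * ip x x.

Definition op_invertible (K : lmodType C) (ip : K -> K -> C) (T : K -> K) : Prop :=
  exists W : K -> K, [/\ bounded_op ip W, T \o W =1 id & W \o T =1 id].

Definition is_adjoint (K : lmodType C) (ip : K -> K -> C) (T S : K -> K) : Prop :=
  forall x y, ip (T x) y = ip x (S y).

Definition normal_op (K : lmodType C) (ip : K -> K -> C) (T : K -> K) : Prop :=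
  bounded_op ip T /\
  exists S : K -> K, [/\ bounded_op ip S, is_adjoint ip T S & T \o S =1 S \o T].

Definition op_spectrum_in (K : lmodType C) (ip : K -> K -> C) (T : K -> K)
    (S : C -> bool) : Prop :=
  forall l : C, ~~ S l -> op_invertible ip (fun x => T x - l *: x).

Definition Ar_unitary (r : R) (K : lmodType C) (ip : K -> K -> C) (T : K -> K) : Prop :=
  normal_op ip T /\ op_spectrum_in ip T (in_bd_annulus r).

Definition mono_op (m : nat) (K : lmodType C) (U : 'I_m -> K -> K)
    (mm : 'X_{1..m}) : K -> K :=
  foldr (fun i f => iter (mm i) (U i) \o f) id (enum 'I_m).
Definition mpoly_op (m : nat) (K : lmodType C) (U : 'I_m -> K -> K)
    (p : {mpoly C[m]}) : K -> K :=
  fun x => \sum_(mm <- msupp p) p@_mm *: mono_op U mm x.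

(* V : C^2 -> K is a linear isometric embedding (identifies H with a subspace of K) *)
Definition isometric_embedding (K : lmodType C) (ip : K -> K -> C)
    (V : 'cV[C]_2 -> K) : Prop :=
  (forall (a : C) x y, V (a *: x + y) = a *: V x + V y) /\
  (forall x y, ip (V x) (V y) = ip2 x y).

(* Main.v *)
(* Let A be the algebra of rational functions on the closed polyannulus, and rho : A -> M_2,
   f |-> f(B). A doubly commuting 2 x 2 tuple is either unitarily diagonal or consists of one
   non-normal matrix and scalars; hence |rho(f)| <= sup |f|, and by the maximum principle the
   supremum may be taken over the distinguished boundary. In an orthonormal basis rho is lower
   triangular with diagonal entries the evaluations at two points b, a, and its corner d is a
   derivation: d(fg) = f(a) dg + df g(b). Contractivity on ker(ev_a), applied to a Cayley-type
   transform of a matrix-valued function F with Re F >= 0, gives 2-positivity of rho. Hahn-Banach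
   extends the resulting positive functional to bounded functions on boundary x (unit sphere of
   C^2); the GNS space of the extension carries the coordinate multiplications, which are the
   required commuting normal operators. Finite additivity suffices: no measure is needed. *)
Require Import Defs.
From HB Require Import structures.
From mathcomp Require Import all_boot all_order all_algebra.
From mathcomp Require Import perm complex.
From mathcomp Require Import boolp classical_sets functions filter reals.
From mathcomp Require Import Rstruct.
From mathcomp Require Import ring lra.
From mathcomp Require Import mpoly.
Import Order.TTheory GRing.Theory Num.Theory ComplexField.Normc.
Set Implicit Arguments. Unset Strict Implicit. Unset Printing Implicit Defensive.
Local Open Scope ring_scope.
Local Open Scope complex_scope.
Local Notation Re := complex.Re.
Local Notation Im := complex.Im.
Local Notation "z ^*" := (@conjc R z) : ring_scope.
Local Notation "z ^*" := (@conjc R z) : complex_scope.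

(** Contractivity bounds scalar functions only, whereas a dilation requires positivity for
    matrix-valued F. The gap closes because rho has a single off-diagonal entry. The vectors dF w2
    and (F(b) - F(a)) w2 are parallel: the derivation rule, applied to a product of two entries of
    (F - F(a)) w2, which vanish at a, cannot depend on the order of the factors. Hence one scalar
    function taken from the Cayley transform carries all the information, and the first column of
    rho of that function gives exactly the estimate required. The functional to be extended sends F
    to the sum over k, l of the (k,l) entry of rho(F_kl). A vector u of C^2, in the triangularising
    basis, becomes the function (z, xi) |-> sum_i xi_i u_i; multiplying it by f and pairing with the
    function of v returns the inner product of rho(f) u with v, and the case f = 1 makes the
    embedding isometric. Compactness of the closed polyannulus and limits in the completion both
    come from one free ultrafilter on the naturals. The GNS completion is realised as a space of
    functionals, so null vectors need not be divided out. *)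

(** * Real-valued modulus, real part and conjugation on the complex numbers *)

Lemma normC_normc (z : C) : `|z| = (normc z)%:C.
Proof. by []. Qed.

Lemma normc_ge0 (z : C) : 0 <= normc z.
Proof. by rewrite -lecR -normC_normc rmorph0 normr_ge0. Qed.

Lemma normcD (x y : C) : normc (x + y) <= normc x + normc y.
Proof. by rewrite -lecR rmorphD /= -!normC_normc ler_normD. Qed.

Lemma normcN (x : C) : normc (- x) = normc x.
Proof. by apply: complexI; rewrite -!normC_normc normrN. Qed.

Lemma normcB (x y : C) : normc (x - y) = normc (y - x).
Proof. by rewrite -normcN opprB. Qed.

Lemma normc_eq0 (x : C) : (normc x == 0) = (x == 0).
Proof. by rewrite -[RHS]normr_eq0 normC_normc eq_complex /= eqxx andbT. Qed.

Lemma normc_gt0 (x : C) : (0 < normc x) = (x != 0).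
Proof. by rewrite lt_def normc_ge0 andbT normc_eq0. Qed.

Lemma normc_real (x : R) : normc x%:C = `|x|.
Proof. by rewrite /normc /= expr0n addr0 sqrtr_sqr. Qed.

Lemma normc_conj (x : C) : normc x^* = normc x.
Proof. by apply: complexI; rewrite -!normC_normc normcJ. Qed.

Lemma normc_Re (x : C) : `|Re x| <= normc x.
Proof. by rewrite -lecR -normC_normc normc_ge_Re. Qed.

Lemma normc_Im (x : C) : `|Im x| <= normc x.
Proof.
have := normc_Re (x * 'i%C); rewrite ReiNIm normrN normcM.
by rewrite /normc /= expr0n expr1n add0r sqrtr1 mulr1.
Qed.

Lemma mulc_conj (x : C) : x * x^* = (normc x ^+ 2)%:C.
Proof. by rewrite -sqr_normc normC_normc rmorphXn. Qed.

Lemma ReD (x y : C) : Re (x + y) = Re x + Re y.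
Proof. by case: x => a b; case: y. Qed.

Lemma ImD (x y : C) : Im (x + y) = Im x + Im y.
Proof. by case: x => a b; case: y. Qed.

Lemma ReB (x y : C) : Re (x - y) = Re x - Re y.
Proof. by case: x => a b; case: y. Qed.

Lemma ReZ (a : R) (x : C) : Re (a%:C * x) = a * Re x.
Proof. by case: x => c d /=; rewrite mul0r subr0. Qed.

Lemma Re_conjc (x : C) : Re x^* = Re x.
Proof. by case: x. Qed.

Lemma conjcM (x y : C) : (x * y)^* = x^* * y^*.
Proof. exact: rmorphM. Qed.

Lemma conjcD (x y : C) : (x + y)^* = x^* + y^*.
Proof. exact: rmorphD. Qed.

Lemma conjcN (x : C) : (- x)^* = - x^*.
Proof. exact: rmorphN. Qed.

Lemma conjcB (x y : C) : (x - y)^* = x^* - y^*.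
Proof. exact: rmorphB. Qed.

Lemma conjc_sum (I : Type) (s : seq I) (f : I -> C) :
  (\sum_(i <- s) f i)^* = \sum_(i <- s) (f i)^*.
Proof. exact: rmorph_sum. Qed.

Lemma conjcR (x : R) : (x%:C)^* = x%:C.
Proof. exact: conjc_real. Qed.

Lemma complex_ext (x y : C) : Re x = Re y -> Im x = Im y -> x = y.
Proof. by case: x => a b; case: y => c d /= -> ->. Qed.

(** * Limits along a free ultrafilter *)

Lemma free_ultrafilter_exists :
  exists U : set_system nat, UltraFilter U /\
    forall N, U [set n | (N <= n)%N]%classic.
Proof.
have [U [UU sU]] := ultraFilterLemma eventually_filter.
by exists U; split=> // N; apply: sU; exists N.
Qed.

(** Along this fixed ultrafilter every bounded sequence has a limit, and limits respect sums,
    products, conjugates and weak inequalities, so no subsequences have to be extracted. *)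
Definition fuf : set_system nat := projT1 (cid free_ultrafilter_exists).

#[local] Instance fuf_ultra : UltraFilter fuf.
Proof. exact: (projT2 (cid free_ultrafilter_exists)).1. Qed.

Lemma fuf_tail N : fuf [set n | (N <= n)%N]%classic.
Proof. exact: (projT2 (cid free_ultrafilter_exists)).2. Qed.

Definition ulim (u : nat -> C) (l : C) : Prop :=
  forall e : R, 0 < e -> fuf [set n | normc (u n - l) < e]%classic.

Lemma fuf_ex (A : set nat) : fuf A -> exists n, A n.
Proof. by move=> /filter_ex. Qed.

Lemma fuf_ex2 (A B : set nat) : fuf A -> fuf B -> exists n, A n /\ B n.
Proof. by move=> FA FB; apply: fuf_ex (filterI FA FB). Qed.

(** The limit is the supremum of the x with x <= [u n] for almost all n. Any larger x fails this,
    and the ultrafilter property turns the failure into [u n] < x for almost all n. *)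
Lemma real_ulim_exists (u : nat -> R) (M : R) :
  (forall n, `|u n| <= M) ->
  exists l, forall e, 0 < e -> fuf [set n | `|u n - l| < e]%classic.
Proof.
move=> bu; pose L : set R := [set x | fuf [set n | x <= u n]%classic]%classic.
have LM : L (- M).
  by apply: (filterS _ (fuf_tail 0)) => n _ /=; have := bu n; rewrite ler_norml => /andP[].
have uL : ubound L M.
  move=> x /fuf_ex[n xn]; apply: le_trans xn _.
  by have := bu n; rewrite ler_norml => /andP[].
have hL : has_sup L by split; [exists (- M) | exists M].
exists (sup L) => e e0.
have [x Lx xe] := sup_adherent e0 hL.
have nL : ~ L (sup L + e).
  by move=> /(ub_le_sup (proj2 hL)); rewrite gerDl leNgt e0.
case: (in_ultra_setVsetC [set n | sup L + e <= u n]%classic fuf_ultra) => // F.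
apply: filterS (filterI F Lx) => n [/= /negP]; rewrite -ltNge => h1 h2.
by rewrite ltr_norml; apply/andP; split; lra.
Qed.

Lemma ulim_bounded (u : nat -> C) (M : R) :
  (forall n, normc (u n) <= M) -> exists l, ulim u l.
Proof.
move=> bu.
have [n|a ha] := @real_ulim_exists (fun n => Re (u n)) M.
  exact: le_trans (normc_Re _) (bu n).
have [n|b hb] := @real_ulim_exists (fun n => Im (u n)) M.
  exact: le_trans (normc_Im _) (bu n).
exists (a +i* b) => e e0; have e2 : 0 < e / 2 by lra.
apply: filterS (filterI (ha _ e2) (hb _ e2)) => n [/= h1 h2].
have -> : u n - (a +i* b) = (Re (u n) - a)%:C + 'i%C * (Im (u n) - b)%:C.
  by apply: complex_ext; case: (u n) => c d /=; ring.
apply: le_lt_trans (normcD _ _) _.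
rewrite normcM !normc_real /normc /= expr0n expr1n add0r sqrtr1 mul1r.
lra.
Qed.

Lemma ulim_unique u l l' : ulim u l -> ulim u l' -> l = l'.
Proof.
move=> ul ul'; apply/eqP; rewrite -subr_eq0 -normc_eq0; apply/eqP.
apply/eqP; rewrite eq_le normc_ge0 andbT; apply/ler_addgt0Pl => e e0.
rewrite addr0; have e2 : 0 < e / 2 by lra.
have [n [/= h1 h2]] := fuf_ex2 (ul _ e2) (ul' _ e2).
have -> : l - l' = (u n - l') - (u n - l) by ring.
by apply: le_trans (normcD _ _) _; rewrite normcN; lra.
Qed.

Lemma ulim_cst c : ulim (fun=> c) c.
Proof.
move=> e e0; apply: (filterS _ (fuf_tail 0)) => n _ /=.
by rewrite subrr normc0.
Qed.

Lemma ulimD u v l k : ulim u l -> ulim v k -> ulim (fun n => u n + v n) (l + k).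
Proof.
move=> ul vk e e0; have e2 : 0 < e / 2 by lra.
apply: filterS (filterI (ul _ e2) (vk _ e2)) => n [/= h1 h2].
rewrite opprD addrACA; apply: le_lt_trans (normcD _ _) _; lra.
Qed.

Lemma ulimM u v l k : ulim u l -> ulim v k -> ulim (fun n => u n * v n) (l * k).
Proof.
move=> ul vk e e0.
pose d := Num.min 1 (e / (normc l + normc k + 2)).
have P0 : 0 < normc l + normc k + 2 by have := normc_ge0 l; have := normc_ge0 k; lra.
have d0 : 0 < d by rewrite lt_min ltr01 divr_gt0.
have d1 : d <= 1 by rewrite ge_min lexx.
have d2 : d * (normc l + normc k + 2) <= e.
  by rewrite -ler_pdivlMr // ge_min lexx orbT.
apply: filterS (filterI (ul _ d0) (vk _ d0)) => n [/= h1 h2].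
have -> : u n * v n - l * k =
   (u n - l) * (v n - k) + (l * (v n - k) + (u n - l) * k) by ring.
apply: le_lt_trans (normcD _ _) _.
have := normcD (l * (v n - k)) ((u n - l) * k); rewrite !normcM.
have := normc_ge0 l; have := normc_ge0 k.
have := normc_ge0 (u n - l); have := normc_ge0 (v n - k); nra.
Qed.

Lemma ulim_conj u l : ulim u l -> ulim (fun n => (u n)^*) l^*.
Proof.
move=> ul e e0; apply: filterS (ul _ e0) => n /=.
by rewrite -rmorphB normc_conj.
Qed.

Lemma ulimN u l : ulim u l -> ulim (fun n => - u n) (- l).
Proof.
move=> ul e e0; apply: filterS (ul _ e0) => n /=.
by rewrite -opprD normcN.
Qed.

Lemma ulimB u v l k : ulim u l -> ulim v k -> ulim (fun n => u n - v n) (l - k).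
Proof. by move=> ul vk; apply: ulimD => //; apply: ulimN. Qed.

Lemma ulim_sum (I : Type) (s : seq I) (u : I -> nat -> C) (l : I -> C) :
  (forall i, ulim (u i) (l i)) ->
  ulim (fun n => \sum_(i <- s) u i n) (\sum_(i <- s) l i).
Proof.
move=> ul; elim: s => [|i s IH].
  by under eq_fun do rewrite big_nil; rewrite big_nil; apply: ulim_cst.
by under eq_fun do rewrite big_cons; rewrite big_cons; apply: ulimD.
Qed.

Lemma ulim_prod (I : Type) (s : seq I) (u : I -> nat -> C) (l : I -> C) :
  (forall i, ulim (u i) (l i)) ->
  ulim (fun n => \prod_(i <- s) u i n) (\prod_(i <- s) l i).
Proof.
move=> ul; elim: s => [|i s IH].
  by under eq_fun do rewrite big_nil; rewrite big_nil; apply: ulim_cst.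
by under eq_fun do rewrite big_cons; rewrite big_cons; apply: ulimM.
Qed.

Lemma ulimX u l k : ulim u l -> ulim (fun n => u n ^+ k) (l ^+ k).
Proof.
move=> ul; elim: k => [|k IH].
  by under eq_fun do rewrite expr0; rewrite expr0; apply: ulim_cst.
by under eq_fun do rewrite exprS; rewrite exprS; apply: ulimM.
Qed.

Lemma ulim_normc_le u l (M : R) :
  ulim u l -> (forall n, normc (u n) <= M) -> normc l <= M.
Proof.
move=> ul uM; apply/ler_addgt0Pr => e e0.
have [n /= h] := fuf_ex (ul _ e0).
have -> : l = u n - (u n - l) by ring.
apply: le_trans (normcD _ _) _; rewrite normcN.
by have := uM n; lra.
Qed.

Lemma ulim_normc_ge u l (M : R) :
  ulim u l -> (forall n, M <= normc (u n)) -> M <= normc l.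
Proof.
move=> ul uM; apply/ler_addgt0Pr => e e0.
have [n /= h] := fuf_ex (ul _ e0).
have := normcD (u n - l) l; rewrite subrK.
by have := uM n; lra.
Qed.

Lemma ulim_Re_le u l (M : R) : ulim u l -> (forall n, Re (u n) <= M) -> Re l <= M.
Proof.
move=> ul uM; apply/ler_addgt0Pr => e e0.
have [n /= h] := fuf_ex (ul _ e0).
have := normc_Re (u n - l); rewrite ReB ler_norml => /andP[h1 _].
by have := uM n; lra.
Qed.

Lemma cvg_ulim u (l : C) : (forall e : R, 0 < e -> exists N, forall n, (N <= n)%N -> normc (u n - l) < e) ->
  ulim u l.
Proof.
move=> h e e0; have [N hN] := h _ e0.
by apply: filterS (fuf_tail N) => n /= /hN.
Qed.

(** * The complex Hahn-Banach theorem *)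

Section HahnBanach.
Variables (V : lmodType C) (p : V -> R).
Hypothesis p_sub : forall x y, p (x + y) <= p x + p y.
Hypothesis p_pos : forall (t : R) x, 0 < t -> p (t%:C *: x) = t * p x.

(** Partial functionals are kept as relations, so unions of chains are easy to form.
    Single-valuedness is not imposed: a pair (0, a) and its multiple by -1 both lie below [p 0] = 0,
    which forces a = 0. *)
Definition dominated_graph (A : set (V * R)) : Prop :=
  [/\ forall x a y b, A (x, a) -> A (y, b) -> A (x + y, a + b),
      forall (t : R) x a, A (x, a) -> A (t%:C *: x, t * a) &
      forall x a, A (x, a) -> a <= p x].

(** The value a at [x0] must lie above every b - p(y - x0) and below every p(z + x0) - c.
    Subadditivity puts each lower bound under each upper one, so the supremum of the lower bounds
    serves. The sign of the coefficient t of [x0] decides which bound is used. *)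
Lemma dominated_graph_extend (A : set (V * R)) (x0 : V) :
  dominated_graph A -> A (0, 0) ->
  exists A', [/\ dominated_graph A', (A `<=` A')%classic & exists a, A' (x0, a)].
Proof.
move=> [AD AZ Ap] A0.
pose S : set R := [set s | exists y b, A (y, b) /\ s = b - p (y - x0)]%classic.
have key y b z c : A (y, b) -> A (z, c) -> b - p (y - x0) <= p (z + x0) - c.
  move=> Ay Az; have := Ap _ _ (AD _ _ _ _ Ay Az).
  have := p_sub (y - x0) (z + x0); rewrite addrACA [- x0 + x0]addNr addr0; lra.
have hS : has_sup S.
  split; first by exists (0 - p (0 - x0)), 0, 0.
  exists (p (0 + x0) - 0) => _ [y [b [Ay ->]]]; exact: key.
set a := sup S.
have a_ge y b : A (y, b) -> b - p (y - x0) <= a.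
  by move=> Ay; apply: (ub_le_sup (proj2 hS)); exists y, b.
have a_le z c : A (z, c) -> a <= p (z + x0) - c.
  by move=> Az; apply: (ge_sup (proj1 hS)) => _ [y [b [Ay ->]]]; exact: key.
exists [set u | exists y b (t : R), A (y, b) /\ u = (y + t%:C *: x0, b + t * a)]%classic.
split; last 2 first.
- by move=> [y b] Ay; exists y, b, 0; split=> //; rewrite scale0r mul0r !addr0.
- by exists a, 0, 0, 1; split=> //; rewrite scale1r mul1r !add0r.
split.
- move=> x1 a1 x2 a2 [y1 [b1 [t1 [A1 [-> ->]]]]] [y2 [b2 [t2 [A2 [-> ->]]]]].
  exists (y1 + y2), (b1 + b2), (t1 + t2); split; first exact: AD.
  by rewrite rmorphD scalerDl mulrDl addrACA [b1 + b2 + _]addrACA.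
- move=> t x1 a1 [y1 [b1 [t1 [A1 [-> ->]]]]].
  exists (t%:C *: y1), (t * b1), (t * t1); split; first exact: AZ.
  by rewrite scalerDr scalerA mulrDr mulrA rmorphM.
move=> x1 a1 [y [b [t [Ay [-> ->]]]]].
have [t0|t0|->] := ltgtP t 0; last by rewrite scale0r mul0r !addr0; exact: Ap.
- have s0 : 0 < - t by lra.
  have := a_ge _ _ (AZ (- t)^-1 _ _ Ay).
  have -> : (- t)^-1%:C *: y - x0 = (- t)^-1%:C *: (y + t%:C *: x0).
    rewrite scalerDr scalerA -rmorphM /= invrN mulNr mulVf ?lt_eqF //.
    by rewrite rmorphN1 scaleN1r.
  rewrite p_pos ?invr_gt0 // -mulrBr ler_pdivrMl // mulNr; lra.
- have := a_le _ _ (AZ t^-1 _ _ Ay).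
  have -> : t^-1%:C *: y + x0 = t^-1%:C *: (y + t%:C *: x0).
    by rewrite scalerDr scalerA -rmorphM /= mulVf ?gt_eqF // scale1r.
  rewrite p_pos ?invr_gt0 // -mulrBr ler_pdivlMl //; lra.
Qed.

Lemma real_Hahn_Banach (G : set (V * R)) : dominated_graph G -> G (0, 0) ->
  exists L : V -> R,
    [/\ forall x y, L (x + y) = L x + L y,
        forall (t : R) x, L (t%:C *: x) = t * L x,
        forall x a, G (x, a) -> L x = a &
        forall x, L x <= p x].
Proof.
move=> dG G0.
(* The inclusion of [G] is demanded only of nonempty A, because Zorn's lemma also asks for the union
   of the empty chain. *)
pose P (A : set (V * R)) := dominated_graph A /\ (forall u, A u -> (G `<=` A)%classic).
have [|A [[[AD AZ Ap] AG] maxA]] := @Zorn_bigcup _ P.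
  move=> F FP totF; split; last first.
    by move=> u [X FX Xu] v Gv; exists X => //; apply: (FP _ FX).2 Xu _ Gv.
  split.
  - move=> x a y b [X FX Xx] [Y FY Yy].
    have [XY|YX] := totF _ _ FX FY.
      by exists Y => //; have [[+ _ _] _] := FP _ FY; apply=> //; apply: XY.
    by exists X => //; have [[+ _ _] _] := FP _ FX; apply=> //; apply: YX.
  - by move=> t x a [X FX Xx]; exists X => //; have [[_ + _] _] := FP _ FX; apply.
  - by move=> x a [X FX Xx]; have [[_ _ +] _] := FP _ FX; apply.
have GA : (G `<=` A)%classic.
  have [A0|/set0P[u Au]] := eqVneq A set0%classic; last exact: AG Au.
  exfalso; apply: (maxA G); last by split=> // u _ v.
  by rewrite A0; split=> [u []|/(_ _ G0)].
have dA : dominated_graph A by [].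
have tot x : exists a, A (x, a).
  have [A' [dA' AA' [a A'a]]] := dominated_graph_extend x dA (GA _ G0).
  exists a; apply: contrapT => nA; apply: (maxA A').
    by split=> // /(_ _ A'a).
  by split=> // u _ v /GA/AA'.
have A00 a : A (0, a) -> a = 0.
  have p0 : p 0 = 0.
    have := @p_pos 2 0; rewrite scaler0 => /(_ (ltr0Sn _ _)); lra.
  move=> Aa; apply/eqP; rewrite eq_le; apply/andP; split.
    by have := Ap _ _ Aa; rewrite p0.
  by have := Ap _ _ (AZ (-1) _ _ Aa); rewrite scaler0 p0; lra.
have Afun x a b : A (x, a) -> A (x, b) -> a = b.
  move=> Aa /(AZ (-1)) Ab; have := AD _ _ _ _ Aa Ab.
  by rewrite rmorphN1 scaleN1r subrr => /A00; lra.
have [L AL] := choice tot.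
exists L; split=> [x y|t x|x a /GA Aa|x].
- exact: Afun (AL _) (AD _ _ _ _ (AL x) (AL y)).
- exact: Afun (AL _) (AZ _ _ _ (AL x)).
- exact: Afun (AL _) Aa.
- exact: Ap (AL x).
Qed.

Lemma complex_Hahn_Banach (G : V -> C -> Prop) :
  G 0 0 ->
  (forall x c y d, G x c -> G y d -> G (x + y) (c + d)) ->
  (forall a x c, G x c -> G (a *: x) (a * c)) ->
  (forall x c, G x c -> Re c <= p x) ->
  exists lam : V -> C,
    [/\ forall a x y, lam (a *: x + y) = a * lam x + lam y,
        forall x c, G x c -> lam x = c &
        forall x, Re (lam x) <= p x].
Proof.
move=> G0 GD GZ Gp.
pose GR : set (V * R) := [set u | exists2 c, G u.1 c & u.2 = Re c]%classic.
have [||L [LD LZ LG Lp]] := @real_Hahn_Banach GR.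
- split.
  + by move=> x a y b [/= c Gc ->] [/= d Gd ->]; exists (c + d); [exact: GD | rewrite ReD].
  + by move=> t x a [/= c Gc ->]; exists (t%:C * c); [exact: GZ | rewrite ReZ].
  + by move=> x a [/= c Gc ->]; exact: Gp.
- by exists 0.
(* The complex-linear functional whose real part is the real-linear L. *)
pose lam x : C := L x -i* L ('i%C *: x).
have LN x : L (- x) = - L x by rewrite -scaleN1r -(rmorphN1 (real_complex R)) LZ; lra.
exists lam; split=> //.
- move=> a x y; apply: complex_ext.
    rewrite ReD /= LD; congr (_ + _).
    have -> : a *: x = (Re a)%:C *: x + (Im a)%:C *: ('i%C *: x).
      by rewrite scalerA -scalerDl; congr (_ *: _); apply: complex_ext;
         case: a => c d /=; ring.
    by rewrite LD !LZ; case: a => c d /=; ring.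
  rewrite ImD /= scalerDr LD.
  have -> : L ('i%C *: (a *: x)) = Re a * L ('i%C *: x) - Im a * L x.
    have -> : 'i%C *: (a *: x) = (Re a)%:C *: ('i%C *: x) + (- Im a)%:C *: x.
      by rewrite !scalerA -scalerDl; congr (_ *: _); apply: complex_ext;
         case: a => c d /=; ring.
    by rewrite LD !LZ; ring.
  by case: a => c d /=; ring.
- move=> x c Gc; apply: complex_ext => /=.
    by apply: LG; exists c.
  have -> : L ('i%C *: x) = Re ('i%C * c) by apply: LG; exists ('i%C * c) => //; exact: GZ.
  by case: c {Gc} => c d /=; ring.
Qed.
End HahnBanach.

(** Errors are measured by squared moduli because all estimates in the completion below bound |phi
    x|^2 by a multiple of [sqn x]. *)
Lemma ulim_close u v l (c : R) :
  (forall n, normc (u n - v n) ^+ 2 <= c * n.+1%:R^-1) -> ulim u l -> ulim v l.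
Proof.
move=> uv ul.
have d0 : ulim (fun n => v n - u n) 0.
  apply: cvg_ulim => e e0.
  exists (Num.trunc (c / e ^+ 2)).+1 => n nN; rewrite subr0 normcB.
  rewrite -(ltr_pXn2r (n := 2)) ?nnegrE ?normc_ge0 ?(ltW e0) //.
  apply: le_lt_trans (uv n) _.
  have e2 : 0 < e ^+ 2 by rewrite exprn_gt0.
  rewrite ltr_pdivrMr ?ltr0Sn // mulrC -ltr_pdivrMr //.
  have [c0|c0] := ltP (c / e ^+ 2) 0; first by apply: lt_trans c0 _; rewrite ltr0Sn.
  apply: lt_le_trans (truncnS_gt _) _.
  by rewrite ler_nat; apply: leq_trans nN _.
have := ulimD d0 ul; rewrite add0r.
by congr ulim; apply/funext => n; rewrite subrK.
Qed.

Lemma normc_sqrD (x y : C) : normc (x + y) ^+ 2 <= 2 * normc x ^+ 2 + 2 * normc y ^+ 2.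
Proof.
have := normcD x y; have := normc_ge0 x; have := normc_ge0 y.
have := normc_ge0 (x + y); have := sqr_ge0 (normc x - normc y); nra.
Qed.

(** * Completion of a semi-inner product space *)

Record semi_inner (E : lmodType C) := SemiInner {
  sform :> E -> E -> C;
  sform_lin : forall a x y z, sform (a *: x + y) z = a * sform x z + sform y z;
  sform_conj : forall x y, sform x y = (sform y x)^*;
  sform_ge0 : forall x, 0 <= sform x x
}.

Section Completion.
Variables (E : lmodType C) (h : semi_inner E).
Let h_lin := sform_lin h.
Let h_conj := sform_conj h.
Let h_ge0 := sform_ge0 h.

Definition sqn (x : E) : R := Re (h x x).

Lemma sqnE x : h x x = (sqn x)%:C.
Proof. by have := h_ge0 x; rewrite lecE /sqn; case: (h x x) => a b /= /andP[/eqP -> _]. Qed.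

Lemma sqn_ge0 x : 0 <= sqn x.
Proof. by rewrite -lecR -sqnE rmorph0. Qed.

Lemma hDl x y z : h (x + y) z = h x z + h y z.
Proof. by rewrite -[x]scale1r h_lin mul1r scale1r. Qed.
Lemma h0l z : h 0 z = 0.
Proof. by apply: (addrI (h 0 z)); rewrite -hDl !addr0. Qed.
Lemma hZl a x z : h (a *: x) z = a * h x z.
Proof. by rewrite -[_ *: _]addr0 h_lin h0l addr0. Qed.
Lemma hBl x y z : h (x - y) z = h x z - h y z.
Proof. by rewrite hDl -scaleN1r hZl mulN1r. Qed.
Lemma hDr x y z : h x (y + z) = h x y + h x z.
Proof. by rewrite h_conj hDl rmorphD /= -!h_conj. Qed.
Lemma hZr a x z : h x (a *: z) = a^* * h x z.
Proof. by rewrite h_conj hZl rmorphM /= -!h_conj. Qed.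
Lemma hBr x y z : h x (y - z) = h x y - h x z.
Proof. by rewrite h_conj hBl rmorphB /= -!h_conj. Qed.

Lemma h_CauchySchwarz x y : normc (h x y) ^+ 2 <= sqn x * sqn y.
Proof.
set c := h x y.
(* The vector x - t c y has nonnegative square for every real t. The factor c removes the phase of h
   x y. *)
have pos (t : R) : 0 <= sqn x - 2 * t * normc c ^+ 2 + t ^+ 2 * normc c ^+ 2 * sqn y.
  have := sqn_ge0 (x - (t%:C * c) *: y).
  suff -> : sqn (x - (t%:C * c) *: y) =
      sqn x - 2 * t * normc c ^+ 2 + t ^+ 2 * normc c ^+ 2 * sqn y by [].
  apply: complexI; rewrite -sqnE hBl !hBr !hZl !hZr [h y x]h_conj -/c !sqnE.
  have := mulc_conj c; move: (normc c ^+ 2) => q cq.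
  have -> : (t%:C * c)^* = t%:C * c^* by rewrite rmorphM; congr (_ * _); exact: conjc_real.
  have -> : (sqn x - 2 * t * q + t ^+ 2 * q * sqn y)%:C =
      (sqn x)%:C - 2 * t%:C * q%:C + t%:C ^+ 2 * q%:C * (sqn y)%:C.
    by rewrite rmorphD rmorphB !rmorphM rmorph_nat.
  by rewrite -cq; ring.
have [y0|yn0] := eqVneq (sqn y) 0.
  rewrite y0 mulr0; have [//|cn0] := leP (normc c ^+ 2) 0.
  (* The form may be degenerate. If y is a null vector, the expression is affine in t, and this t
     gives it the value -1. *)
  have := pos ((sqn x + 1) / (2 * normc c ^+ 2)).
  rewrite y0 mulr0 addr0.
  have -> : 2 * ((sqn x + 1) / (2 * normc c ^+ 2)) * normc c ^+ 2 = sqn x + 1.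
    by field; have := cn0; rewrite exprn_even_gt0 //= => ->.
  lra.
have := pos (sqn y)^-1.
have -> : sqn x - 2 * (sqn y)^-1 * normc c ^+ 2 + (sqn y)^-1 ^+ 2 * normc c ^+ 2 * sqn y
   = (sqn x * sqn y - normc c ^+ 2) / sqn y by field.
by rewrite pmulr_lge0 ?invr_gt0 ?lt_def ?yn0 ?sqn_ge0 // subr_ge0.
Qed.

(* Elements of the completion are the functionals [h f _] and their limits in the dual norm. *)
Definition approximable (phi : E -> C) : Prop :=
  forall e : R, 0 < e -> exists f, forall x, normc (phi x - h f x) ^+ 2 <= e * sqn x.

Definition completion_pred : {pred (E -> C)} := fun phi => `[< approximable phi >].

Lemma completion_submod : submod_closed completion_pred.
Proof.
split.
  apply/asboolP => e e0; exists 0 => x.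
  have -> : (0 : E -> C) x - h 0 x = 0 by rewrite h0l subr0.
  by rewrite normc0 expr0n /= mulr_ge0 ?sqn_ge0 ?ltW.
move=> a phi psi /asboolP aphi /asboolP apsi; apply/asboolP => e e0.
have k0 : 0 < 2 * (normc a ^+ 2 + 1).
  by have := sqr_ge0 (normc a); lra.
have [f hf] := aphi (e / (2 * (2 * (normc a ^+ 2 + 1)))) (divr_gt0 e0 (mulr_gt0 (ltr0Sn _ 1) k0)).
have [g hg] := apsi (e / 4) ltac:(lra).
exists (a *: f + g) => x; rewrite h_lin.
have -> : (a *: phi + psi) x - (a * h f x + h g x) =
   a * (phi x - h f x) + (psi x - h g x).
  by change ((a *: phi + psi) x) with (a * phi x + psi x); ring.
apply: le_trans (normc_sqrD _ _) _; rewrite normcM exprMn.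
have := hg x; have := hf x; have x0 := sqn_ge0 x.
set P := normc (phi x - _) ^+ 2; set Q := normc (psi x - _) ^+ 2 => hP hQ.
have : normc a ^+ 2 * P <= e / 4 * sqn x.
  apply: (le_trans (y := (normc a ^+ 2 + 1) * P)).
    by rewrite ler_wpM2r ?sqr_ge0 // lerDl ler01.
  rewrite mulrC -ler_pdivlMr; last by have := k0; lra.
  apply: le_trans hP _; rewrite le_eqVlt; apply/orP; left; apply/eqP.
  by field; have := k0; case: eqP => // ->; rewrite mulr0 ltxx.
lra.
Qed.

HB.instance Definition _ := GRing.isSubmodClosed.Build C (E -> C) completion_pred completion_submod.

Record completion := Completion
  { completion_val :> E -> C; completion_valP : completion_val \in completion_pred }.

HB.instance Definition _ := [isSub for completion_val].
HB.instance Definition _ := [Choice of completion by <:].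
HB.instance Definition _ := [SubChoice_isSubLmodule of completion by <:].

Implicit Types phi psi : completion.

Lemma completion_ext phi psi : (forall x, phi x = psi x) -> phi = psi.
Proof. by move=> e; apply: val_inj; apply/funext. Qed.

Lemma completionZD a phi psi x : (a *: phi + psi) x = a * phi x + psi x.
Proof. by []. Qed.

Lemma completionB phi psi x : (phi - psi) x = phi x - psi x.
Proof. by []. Qed.

Lemma completion_approx phi : approximable phi.
Proof. exact/asboolP/completion_valP. Qed.

Lemma approx_seq_exists phi : exists s : nat -> E, forall n x,
  normc (phi x - h (s n) x) ^+ 2 <= n.+1%:R^-1 * sqn x.
Proof.
have H n : exists f, forall x, normc (phi x - h f x) ^+ 2 <= n.+1%:R^-1 * sqn x.
  by apply: completion_approx; rewrite invr_gt0 ltr0Sn.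
by have [s hs] := choice H; exists s.
Qed.

Definition aseq phi : nat -> E := projT1 (cid (approx_seq_exists phi)).

Lemma aseqP phi n x : normc (phi x - h (aseq phi n) x) ^+ 2 <= n.+1%:R^-1 * sqn x.
Proof. exact: (projT2 (cid (approx_seq_exists phi))). Qed.

Lemma invSn_ge0 n : 0 <= n.+1%:R^-1 :> R. Proof. by rewrite invr_ge0. Qed.
Lemma invSn_le1 n : n.+1%:R^-1 <= 1 :> R.
Proof. by rewrite invf_le1 ?ltr0Sn // ler1n. Qed.

Lemma aseq_close phi n x (c : R) : sqn x <= c ->
  normc (phi x - h (aseq phi n) x) ^+ 2 <= c * n.+1%:R^-1.
Proof.
by move=> xc; apply: le_trans (aseqP _ _ _) _; rewrite mulrC ler_wpM2r ?invSn_ge0.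
Qed.

(** A crude bound for the squared dual norm, obtained from the approximant of index 0, whose squared
    error is at most 1 times [sqn x]. The exact value [csqn] needs [cip], whose existence relies on
    this bound. *)
Definition bnd phi : R := 2 * sqn (aseq phi 0) + 2.

Lemma bnd_ge0 phi : 0 <= bnd phi.
Proof. by rewrite /bnd; have := sqn_ge0 (aseq phi 0); lra. Qed.

Lemma bndP phi x : normc (phi x) ^+ 2 <= bnd phi * sqn x.
Proof.
have -> : phi x = (phi x - h (aseq phi 0) x) + h (aseq phi 0) x by ring.
apply: le_trans (normc_sqrD _ _) _; rewrite /bnd.
have := aseqP phi 0 x; rewrite invr1.
have := h_CauchySchwarz (aseq phi 0) x; lra.
Qed.

(** Testing phi on its own approximant s bounds (sqn s)^2 = |h s s|^2 by a constant times sqn s; one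
    factor then cancels. *)
Lemma sqn_aseq phi n : sqn (aseq phi n) <= 2 * bnd phi + 2.
Proof.
set s := aseq phi n; have s0 := sqn_ge0 s.
have : sqn s ^+ 2 <= (2 * bnd phi + 2) * sqn s.
  have -> : sqn s ^+ 2 = normc (phi s + - (phi s - h s s)) ^+ 2.
    have -> : phi s + - (phi s - h s s) = h s s by ring.
    by rewrite sqnE normc_real ger0_norm.
  apply: le_trans (normc_sqrD _ _) _; rewrite normcN.
  have h1 := bndP phi s.
  have h2 : normc (phi s - h s s) ^+ 2 <= 1 * sqn s.
    by apply: le_trans (aseqP phi n s) _; rewrite ler_wpM2r ?invSn_le1.
  lra.
have [->|sn0] := eqVneq (sqn s) 0; first by have := bnd_ge0 phi; lra.
by rewrite expr2 ler_pM2r // lt_def sn0.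
Qed.

Lemma aseq_ulim phi x : ulim (fun n => h (aseq phi n) x) (phi x).
Proof.
apply: (@ulim_close (fun=> phi x) _ _ (sqn x)); last exact: ulim_cst.
by move=> n; apply: aseq_close.
Qed.

Lemma completion_antilinear phi a x y : phi (a *: x + y) = a^* * phi x + phi y.
Proof.
apply: ulim_unique (aseq_ulim _ _) _.
under eq_fun do rewrite hDr hZr.
by apply: ulimD (aseq_ulim _ _); apply: ulimM (aseq_ulim _ _); exact: ulim_cst.
Qed.

(** If psi were h g, the inner product would be phi g; in general g is replaced by the approximants
    of psi. The sequence is bounded, so its limit exists and the default 0 is never taken. *)
Definition cip phi psi : C := xget 0 (ulim (fun n => phi (aseq psi n))).

Lemma cipP phi psi : ulim (fun n => phi (aseq psi n)) (cip phi psi).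
Proof.
have [|l hl] := @ulim_bounded (fun n => phi (aseq psi n)) (1 + bnd phi * (2 * bnd psi + 2)).
  move=> n; have := bndP phi (aseq psi n); have := sqn_aseq psi n.
  have := bnd_ge0 phi; have := normc_ge0 (phi (aseq psi n)).
  move: (normc _) (sqn _) (bnd _) => a b c a0 c0 bc ab.
  have : a ^+ 2 <= c * (2 * bnd psi + 2) by apply: le_trans ab _; rewrite ler_wpM2l.
  have := sqr_ge0 (a - 1); rewrite sqrrB1; nra.
by rewrite /cip; case: xgetP => [l' -> //|/(_ l)].
Qed.

Lemma cipPP phi psi : ulim (fun n => h (aseq phi n) (aseq psi n)) (cip phi psi).
Proof.
apply: ulim_close (cipP phi psi) => n; apply: aseq_close.
exact: sqn_aseq.
Qed.

Lemma cip_lin a phi psi chi : cip (a *: phi + psi) chi = a * cip phi chi + cip psi chi.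
Proof.
apply: ulim_unique (cipP _ _) _.
under eq_fun do rewrite completionZD.
by apply: ulimD; [apply: ulimM; [exact: ulim_cst | ] | ]; apply: cipP.
Qed.

Lemma cip_conj phi psi : cip phi psi = (cip psi phi)^*.
Proof.
apply: ulim_unique (cipPP _ _) _.
under eq_fun do rewrite h_conj.
exact/ulim_conj/cipPP.
Qed.

Lemma cip_ge0 phi : 0 <= cip phi phi.
Proof.
rewrite lecE; apply/andP; split.
  by have := cip_conj phi phi; case: (cip phi phi) => a b [/= ?]; apply/eqP; lra.
have H := @ulim_Re_le _ _ 0 (ulimN (cipPP phi phi)).
have : Re (- cip phi phi) <= 0.
  by apply: H => n; rewrite sqnE -rmorphN /= oppr_le0 sqn_ge0.
by case: (cip _ _) => a b /=; lra.
Qed.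

(** This is the squared dual norm: the two bounds [csqnP] and [csqn_le] make it the least e >= 0
    with |phi x|^2 <= e * [sqn x] for all x. *)
Definition csqn phi : R := Re (cip phi phi).

Lemma csqnE phi : cip phi phi = (csqn phi)%:C.
Proof. by have := cip_ge0 phi; rewrite lecE /csqn; case: (cip _ _) => a b /= /andP[/eqP -> _]. Qed.

Lemma csqn_ge0 phi : 0 <= csqn phi.
Proof. by rewrite -lecR -csqnE rmorph0 cip_ge0. Qed.

Lemma csqnP phi x : normc (phi x) ^+ 2 <= csqn phi * sqn x.
Proof.
have px := aseq_ulim phi x.
have H := @ulim_Re_le _ _ 0
  (ulimB (ulimM px (ulim_conj px)) (ulimM (cipPP phi phi) (ulim_cst (sqn x)%:C))).
rewrite -subr_le0.
have := H _; rewrite mulc_conj csqnE -rmorphM -rmorphB /=; apply=> n.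
by rewrite mulc_conj sqnE -rmorphM -rmorphB /= subr_le0 h_CauchySchwarz.
Qed.

Lemma csqn_le phi (e : R) : 0 <= e ->
  (forall x, normc (phi x) ^+ 2 <= e * sqn x) -> csqn phi <= e.
Proof.
move=> e0 be.
have H := @ulim_Re_le _ _ 0 (ulimB (ulimM (cipP phi phi) (ulim_conj (cipP phi phi)))
                                   (ulimM (ulim_cst e%:C) (cipPP phi phi))).
have : csqn phi ^+ 2 - e * csqn phi <= 0.
  have := H _; rewrite mulc_conj csqnE normc_real -rmorphM -rmorphB /=.
  rewrite real_normK ?num_real //; apply=> n.
  by rewrite mulc_conj sqnE -rmorphM -rmorphB /= subr_le0 be.
have := csqn_ge0 phi; set t := csqn phi => t0.
have [-> //|tn0] := eqVneq t 0.
by rewrite subr_le0 expr2 ler_pM2r // lt_def tn0.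
Qed.

Lemma csqn_eq0 phi : csqn phi = 0 -> phi = 0.
Proof.
move=> p0; apply: completion_ext => x; apply/eqP.
rewrite -normc_eq0 -sqrf_eq0 eq_le sqr_ge0 andbT.
by have := csqnP phi x; rewrite p0 mul0r.
Qed.

(** For completeness, a Cauchy sequence of functionals converges at each point, and the Cauchy bound
    passes to the limit uniformly relative to [sqn]. An approximant of a late term then approximates
    the limit, which therefore stays in the space. *)
Lemma completion_hilbert : is_hilbert cip.
Proof.
split; [exact: cip_lin | exact: cip_conj | exact: cip_ge0 | | ].
  by move=> phi; rewrite csqnE => -[/csqn_eq0].
move=> s cs.
have {}cs (e : R) : 0 < e -> exists N, forall n k, (N <= n)%N -> (N <= k)%N ->
    csqn (s n - s k) < e.
  move=> e0; have [|N hN] := cs e%:C; first by rewrite -(rmorph0 (real_complex R)) ltcR.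
  by exists N => n k Nn Nk; have := hN n k Nn Nk; rewrite csqnE ltcR.
have cx x (e : R) : 0 < e -> exists N, forall n k, (N <= n)%N -> (N <= k)%N ->
    normc (s n x - s k x) < e.
  move=> e0; have p0 : 0 < e ^+ 2 / (sqn x + 1).
    by rewrite divr_gt0 ?exprn_gt0 //; have := sqn_ge0 x; lra.
  have [N hN] := cs _ p0; exists N => n k Nn Nk.
  rewrite -(ltr_pXn2r (n := 2)) ?nnegrE ?normc_ge0 ?(ltW e0) //.
  have := hN n k Nn Nk; rewrite ltr_pdivlMr; last by have := sqn_ge0 x; lra.
  have := csqnP (s n - s k) x; rewrite completionB.
  have := csqn_ge0 (s n - s k); lra.
have lx x : exists l, ulim (fun n => s n x) l.
  have [N hN] := cx x 1 ltr01.
  have [|l hl] := @ulim_bounded (fun n => s (N + n)%N x) (normc (s N x) + 1).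
    move=> n; have := normcD (s (N + n)%N x - s N x) (s N x); rewrite subrK.
    have := hN (N + n)%N N (leq_addr _ _) (leqnn _); lra.
  exists l; apply: cvg_ulim => e e0; have e2 : 0 < e / 2 by lra.
  have [N' hN'] := cx x _ e2; exists N' => n Nn.
  have [k [/= h1 h2]] := fuf_ex2 (hl _ e2) (fuf_tail N').
  have -> : s n x - l = (s n x - s (N + k)%N x) + (s (N + k)%N x - l) by ring.
  apply: le_lt_trans (normcD _ _) _.
  have := hN' n (N + k)%N Nn (leq_trans h2 (leq_addl _ _)); lra.
have [phi0 hphi0] := choice lx.
have close (e : R) : 0 < e -> exists N, forall n, (N <= n)%N ->
    forall x, normc (s n x - phi0 x) ^+ 2 <= e * sqn x.
  move=> e0; have [N hN] := cs _ e0; exists N => n Nn x.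
  apply/ler_addgt0Pr => d d0.
  have dl := ulimB (ulim_cst (s n x)) (hphi0 x).
  have dd := ulimM dl (ulim_conj dl).
  have [k [/= h1 h2]] := fuf_ex2 (dd _ d0) (fuf_tail N).
  move: h1; rewrite !mulc_conj -rmorphB normc_real ltr_norml => /andP[h1 _].
  have := csqnP (s n - s k) x; rewrite completionB.
  have := ler_wpM2r (sqn_ge0 x) (ltW (hN n k Nn h2)); lra.
have Kphi : phi0 \in completion_pred.
  apply/asboolP => e e0; have e4 : 0 < e / 4 by lra.
  have [N hN] := close _ e4; have [f hf] := completion_approx (s N) e4.
  exists f => x.
  have -> : phi0 x - h f x = - (s N x - phi0 x) + (s N x - h f x) by ring.
  apply: le_trans (normc_sqrD _ _) _; rewrite normcN.
  have := hN N (leqnn _) x; have := hf x; lra.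
exists (Completion Kphi) => e; rewrite ltcE => /andP[/eqP ie re].
have e2 : 0 < Re e / 2 by rewrite /= in re; lra.
have [N hN] := close _ e2; exists N => n Nn.
rewrite csqnE ltcE /= ie eqxx /=.
apply: (@le_lt_trans _ _ (Re e / 2)); last by rewrite /= in re; lra.
by apply: csqn_le => [|x]; [lra | exact: hN].
Qed.

Lemma embed_subproof f : h f \in completion_pred.
Proof.
apply/asboolP => e e0; exists f => x.
by rewrite subrr normc0 expr0n /= mulr_ge0 ?sqn_ge0 ?ltW.
Qed.

Definition embed f : completion := Completion (embed_subproof f).

Lemma embed_lin a f g : embed (a *: f + g) = a *: embed f + embed g.
Proof. by apply: completion_ext => x; rewrite completionZD /= h_lin. Qed.

(** Reproducing property: evaluation at f is the inner product with the embedded f, so inner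
    products with embedded vectors involve no limit. *)
Lemma cip_embedr phi f : cip phi (embed f) = phi f.
Proof.
apply: ulim_unique (cipP _ _) _.
apply: (@ulim_close (fun=> phi f) _ _ (bnd phi)); last exact: ulim_cst.
move=> n; set s := aseq _ n.
have -> : phi f - phi s = phi (f - s).
  by rewrite -[f - s]addrC -scaleN1r completion_antilinear rmorphN1 mulN1r addrC.
apply: le_trans (bndP _ _) _.
rewrite ler_wpM2l ?bnd_ge0 //.
(* The error functional h (f - s), tested on f - s itself, bounds sqn (f - s) by 1 / (n + 1). *)
have := aseqP (embed f) n (f - s); rewrite -/s /= -hBl sqnE normc_real.
rewrite real_normK ?num_real // expr2.
have [->|n0] := eqVneq (sqn (f - s)) 0; first by rewrite invSn_ge0.
by rewrite ler_pM2r // lt_def n0 sqn_ge0.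
Qed.

Section Operator.
Variables (M M' : E -> E) (c : R).
Hypothesis M_adj : forall x y, h (M x) y = h x (M' y).
Hypothesis M'_bnd : forall x, sqn (M' x) <= c * sqn x.

Lemma extend_subproof phi : phi \o M' \in completion_pred.
Proof.
apply/asboolP => e e0.
have c0 : 0 < `|c| + 1 by have := normr_ge0 c; lra.
have [f hf] := completion_approx phi (divr_gt0 e0 c0).
exists (M f) => x; rewrite M_adj /=; apply: le_trans (hf _) _.
rewrite mulrAC ler_pdivrMr // -mulrA ler_pM2l //.
apply: le_trans (M'_bnd x) _; rewrite mulrC ler_wpM2l ?sqn_ge0 //.
by have := ler_norm c; lra.
Qed.

(** Since h (M f) x = h f (M' x), precomposing with the formal adjoint M' continues M from E to the
    completion; the bound on M' keeps the result approximable. *)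
Definition extend phi : completion := Completion (extend_subproof phi).

Lemma extend_bounded : bounded_op cip extend.
Proof.
split=> [a phi psi|]; first exact: completion_ext.
exists `|c|%:C => phi; rewrite !csqnE -rmorphM lecR.
apply: csqn_le => [|x]; first by rewrite mulr_ge0 ?csqn_ge0.
apply: le_trans (csqnP phi (M' x)) _; rewrite -mulrA mulrCA.
rewrite ler_wpM2l ?csqn_ge0 //; apply: le_trans (M'_bnd x) _.
by rewrite ler_wpM2r ?sqn_ge0 // ler_norm.
Qed.
End Operator.

Lemma extend_adjoint (M M' : E -> E) (c : R)
    (M_adj : forall x y, h (M x) y = h x (M' y))
    (M'_adj : forall x y, h (M' x) y = h x (M y))
    (M'_bnd : forall x, sqn (M' x) <= c * sqn x)
    (M_bnd : forall x, sqn (M x) <= c * sqn x) :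
  is_adjoint cip (extend M_adj M'_bnd) (extend M'_adj M_bnd).
Proof.
have c1 : 0 <= `|c| by [].
have bd f psi n : (forall x, sqn (f x) <= c * sqn x) ->
    sqn (f (aseq psi n)) <= `|c| * (2 * bnd psi + 2).
  move=> hf; apply: le_trans (hf _) _.
  apply: (@le_trans _ _ (`|c| * sqn (aseq psi n))).
    by rewrite ler_wpM2r ?sqn_ge0 ?ler_norm.
  by rewrite ler_wpM2l ?sqn_aseq.
move=> phi psi.
have l1 : ulim (fun n => h (aseq phi n) (M' (aseq psi n)))
               (cip (extend M_adj M'_bnd phi) psi).
  apply: ulim_close (cipP _ _) => n /=; apply: aseq_close.
  exact: bd.
apply: ulim_unique l1 _; rewrite [cip phi _]cip_conj.
under eq_fun do rewrite -M_adj h_conj.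
apply: ulim_conj; apply: ulim_close (cipP _ _) => n /=; apply: aseq_close.
exact: bd.
Qed.
End Completion.

(** * Bounded functions and the GNS construction *)

Section BoundedFunctions.
Variable Y : Type.

Definition bounded_pred : {pred (Y -> C)} :=
  fun f => `[< exists M : R, forall y, normc (f y) <= M >].

Lemma bounded_submod : submod_closed bounded_pred.
Proof.
split; first by apply/asboolP; exists 0 => y; rewrite normc0.
move=> a f g /asboolP[M hM] /asboolP[N hN]; apply/asboolP.
exists (normc a * M + N) => y; apply: le_trans (normcD _ _) _.
by rewrite normcM lerD // ler_wpM2l ?normc_ge0.
Qed.

HB.instance Definition _ := GRing.isSubmodClosed.Build C (Y -> C) bounded_pred bounded_submod.

Record bfun := Bfun { bfun_val :> Y -> C; bfun_valP : bfun_val \in bounded_pred }.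

HB.instance Definition _ := [isSub for bfun_val].
HB.instance Definition _ := [Choice of bfun by <:].
HB.instance Definition _ := [SubChoice_isSubLmodule of bfun by <:].

Lemma bfun_ext (f g : bfun) : (forall y, f y = g y) -> f = g.
Proof. by move=> e; apply: val_inj; apply/funext. Qed.

Lemma bfun_bnd (f : bfun) : exists M : R, forall y, normc (f y) <= M.
Proof. exact/asboolP/bfun_valP. Qed.

Lemma bfunZD a (f g : bfun) y : (a *: f + g) y = a * f y + g y.
Proof. by []. Qed.

Lemma bmul_subproof (f g : bfun) : (fun y => f y * g y) \in bounded_pred.
Proof.
have [M hM] := bfun_bnd f; have [N hN] := bfun_bnd g.
apply/asboolP; exists (M * N) => y; rewrite normcM.
by apply: ler_pM; rewrite ?normc_ge0.
Qed.

Definition bmul f g : bfun := Bfun (bmul_subproof f g).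

Lemma bconj_subproof (f : bfun) : (fun y => (f y)^*) \in bounded_pred.
Proof. by have [M hM] := bfun_bnd f; apply/asboolP; exists M => y; rewrite normc_conj. Qed.

Definition bconj f : bfun := Bfun (bconj_subproof f).

Lemma bcst_subproof (c : C) : (fun y => c) \in bounded_pred.
Proof. by apply/asboolP; exists (normc c). Qed.

Definition bcst c : bfun := Bfun (bcst_subproof c).

Section GNS.
Variable lam : bfun -> C.
Hypothesis lam_lin : forall a f g, lam (a *: f + g) = a * lam f + lam g.
Hypothesis lam_pos : forall f : bfun, (forall y, 0 <= f y) -> 0 <= lam f.

Lemma lamD f g : lam (f + g) = lam f + lam g.
Proof. by rewrite -[f]scale1r lam_lin mul1r scale1r. Qed.
Lemma lam0 : lam 0 = 0.
Proof. by apply: (addrI (lam 0)); rewrite -lamD !addr0. Qed.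
Lemma lamZ a f : lam (a *: f) = a * lam f.
Proof. by rewrite -[_ *: _]addr0 lam_lin lam0 addr0. Qed.

Lemma real_of_ge0 (z : C) : 0 <= z -> z^* = z.
Proof. by rewrite lecE; case: z => a b /= /andP[/eqP -> _]; rewrite oppr0. Qed.

(** Adding a constant that dominates |f| makes f nonnegative, and [lam] is real on nonnegative
    functions. *)
Lemma lam_real (f : bfun) : (forall y, (f y)^* = f y) -> (lam f)^* = lam f.
Proof.
move=> fr; have [M hM] := bfun_bnd f.
have M0 : 0 <= lam (bcst (`|M|%:C)) by apply: lam_pos => y; rewrite ler0c.
have : 0 <= lam (f + bcst (`|M|%:C)).
  apply: lam_pos => y; have := hM y; have := normc_Re (f y); have := ler_norm M.
  change ((f + bcst `|M|%:C) y) with (f y + `|M|%:C).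
  have := fr y; case: (f y) => a b [/= hb] h1 h2 h3; rewrite lecE /=; apply/andP; split.
    by apply/eqP; lra.
  by have := ler_norm (- a); rewrite normrN; lra.
move=> /real_of_ge0; rewrite lamD conjcD (real_of_ge0 M0).
by move=> /addIr.
Qed.

Lemma lam_conj f : lam (bconj f) = (lam f)^*.
Proof.
pose re : bfun := (2^-1) *: (f + bconj f).
pose im : bfun := (2^-1 * - 'i%C) *: (f - bconj f).
have two : (2^-1 : C)^* = 2^-1 by rewrite conjc_inv conjc_nat.
have ii : ('i%C : C)^* = - 'i%C by apply: complex_ext; rewrite /= ?oppr0.
have i2 : ('i%C : C) * 'i%C = - 1 by rewrite -expr2 sqr_i.
have rer : (lam re)^* = lam re.
  apply: lam_real => y; change (re y) with (2^-1 * (f y + (f y)^*)).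
  by rewrite conjcM conjcD two conjcK addrC.
have imr : (lam im)^* = lam im.
  apply: lam_real => y; change (im y) with (2^-1 * - 'i%C * (f y - (f y)^*)).
  by rewrite !conjcM conjcB conjcN two ii conjcK; ring.
have ef : f = 'i%C *: im + re.
  apply: bfun_ext => y.
  change (f y = 'i%C * (2^-1 * - 'i%C * (f y - (f y)^*)) + 2^-1 * (f y + (f y)^*)).
  have -> : 'i%C * (2^-1 * - 'i%C * (f y - (f y)^*)) =
      - ('i%C * 'i%C) * (2^-1 * (f y - (f y)^*)) by ring.
  by rewrite i2; field.
have ef' : bconj f = (- 'i%C) *: im + re.
  apply: bfun_ext => y.
  change ((f y)^* = - 'i%C * (2^-1 * - 'i%C * (f y - (f y)^*)) + 2^-1 * (f y + (f y)^*)).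
  have -> : - 'i%C * (2^-1 * - 'i%C * (f y - (f y)^*)) =
      ('i%C * 'i%C) * (2^-1 * (f y - (f y)^*)) by ring.
  by rewrite i2; field.
by rewrite ef' [in RHS]ef !lam_lin conjcD conjcM ii imr rer.
Qed.

Definition gnsf (f g : bfun) : C := lam (bmul f (bconj g)).

Lemma gnsf_lin a f g k : gnsf (a *: f + g) k = a * gnsf f k + gnsf g k.
Proof.
rewrite /gnsf -lam_lin; congr lam; apply: bfun_ext => y.
change ((a * f y + g y) * (k y)^* = a * (f y * (k y)^*) + g y * (k y)^*); ring.
Qed.

Lemma gnsf_conj f g : gnsf f g = (gnsf g f)^*.
Proof.
rewrite /gnsf -lam_conj; congr lam; apply: bfun_ext => y /=.
by rewrite conjcM conjcK mulrC.
Qed.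

Lemma gnsf_ge0 f : 0 <= gnsf f f.
Proof. by apply: lam_pos => y /=; rewrite mulc_conj ler0c sqr_ge0. Qed.

Definition gns_inner : semi_inner bfun := SemiInner gnsf_lin gnsf_conj gnsf_ge0.
Definition gns := completion gns_inner.

Definition bsup (g : bfun) : R := projT1 (cid (bfun_bnd g)).

Lemma bsupP (g : bfun) y : normc (g y) <= bsup g.
Proof. exact: (projT2 (cid (bfun_bnd g))). Qed.

Lemma bconjK g : bconj (bconj g) = g.
Proof. by apply: bfun_ext => y /=; rewrite conjcK. Qed.

Lemma bmul_adj g x y : gns_inner (bmul g x) y = gns_inner x (bmul (bconj g) y).
Proof.
rewrite /gns_inner /= /gnsf; congr lam; apply: bfun_ext => t /=.
by rewrite conjcM conjcK; ring.
Qed.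

Lemma bmul_adj' g x y : gns_inner (bmul (bconj g) x) y = gns_inner x (bmul g y).
Proof. by rewrite bmul_adj bconjK. Qed.

(** The function c^2 |x|^2 - |g x|^2 is nonnegative, and [lam] is positive. *)
Lemma bmul_bnd (g : bfun) (c : R) x : (forall y, normc (g y) <= c) ->
  sqn gns_inner (bmul g x) <= c ^+ 2 * sqn gns_inner x.
Proof.
move=> gc; rewrite -lecR rmorphM /= -!sqnE /= /gnsf -subr_ge0 -lamZ.
have -> : ((c ^+ 2)%:C *: bmul x (bconj x) : bfun) =
    ((c ^+ 2)%:C *: bmul x (bconj x) - bmul (bmul g x) (bconj (bmul g x)))
    + bmul (bmul g x) (bconj (bmul g x)) by rewrite subrK.
rewrite lamD addrK; apply: lam_pos => y.
change (0 <= (c ^+ 2)%:C * (x y * (x y)^*) - g y * x y * (g y * x y)^*).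
rewrite !mulc_conj -rmorphM -rmorphB ler0c subr_ge0 normcM exprMn.
rewrite ler_wpM2r ?sqr_ge0 // ler_pXn2r ?nnegrE ?normc_ge0 //.
exact: le_trans (normc_ge0 _) (gc y).
Qed.

Lemma bmul_bsup g x : sqn gns_inner (bmul g x) <= bsup g ^+ 2 * sqn gns_inner x.
Proof. by apply: bmul_bnd => y; exact: bsupP. Qed.

Lemma bmul_bsup' g x : sqn gns_inner (bmul (bconj g) x) <= bsup g ^+ 2 * sqn gns_inner x.
Proof. by apply: bmul_bnd => y /=; rewrite normc_conj bsupP. Qed.

Definition mulop (g : bfun) : gns -> gns := extend (bmul_adj g) (bmul_bsup' g).

Lemma mulopE g phi x : mulop g phi x = phi (bmul (bconj g) x).
Proof. by []. Qed.

Lemma mulop_bounded g : bounded_op (@cip _ gns_inner) (mulop g).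
Proof. exact: extend_bounded. Qed.

Lemma mulop_adjoint g : is_adjoint (@cip _ gns_inner) (mulop g) (mulop (bconj g)).
Proof.
move=> phi psi.
rewrite (extend_adjoint (bmul_adj g) (bmul_adj' g) (bmul_bsup' g) (bmul_bsup g)).
by congr cip; apply: completion_ext => x; rewrite mulopE bconjK.
Qed.

Lemma mulopM f g phi : mulop (bmul f g) phi = mulop f (mulop g phi).
Proof.
apply: completion_ext => x; rewrite !mulopE; congr (completion_val phi _).
by apply: bfun_ext => y /=; rewrite conjcM; ring.
Qed.

Lemma mulop_lin a f g phi : mulop (a *: f + g) phi = a *: mulop f phi + mulop g phi.
Proof.
apply: completion_ext => x; rewrite completionZD !mulopE.
have -> : bmul (bconj (a *: f + g)) x = a^* *: bmul (bconj f) x + bmul (bconj g) x.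
  apply: bfun_ext => y.
  change ((a * f y + g y)^* * x y = a^* * ((f y)^* * x y) + (g y)^* * x y).
  by rewrite conjcD conjcM; ring.
by rewrite completion_antilinear conjcK.
Qed.

Lemma mulop1 phi : mulop (bcst 1) phi = phi.
Proof.
apply: completion_ext => x; rewrite mulopE; congr (completion_val phi _).
by apply: bfun_ext => y; change ((1 : C)^* * x y = x y); rewrite conjc1 mul1r.
Qed.

Lemma mulop0 phi : mulop 0 phi = 0.
Proof.
have e : (0 : bfun) = (-1) *: 0 + 0 by rewrite scaler0 addr0.
by rewrite [in LHS]e mulop_lin scaleN1r addNr.
Qed.

Lemma mulopC f g phi : mulop f (mulop g phi) = mulop g (mulop f phi).
Proof. by rewrite -!mulopM; congr mulop; apply: bfun_ext => y /=; rewrite mulrC. Qed.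

Lemma cip_mulop g f k :
  cip (mulop g (embed gns_inner f)) (embed gns_inner k) = lam (bmul g (bmul f (bconj k))).
Proof.
rewrite cip_embedr mulopE /= /gnsf; congr lam; apply: bfun_ext => y /=.
by rewrite conjcM conjcK; ring.
Qed.

Lemma mulop_normal g : normal_op (@cip _ gns_inner) (mulop g).
Proof.
split; first exact: mulop_bounded.
exists (mulop (bconj g)); split; [exact: mulop_bounded | exact: mulop_adjoint | ].
by move=> phi /=; exact: mulopC.
Qed.

Lemma mulop_inverse (g w : bfun) : (forall y, w y * g y = 1) ->
  mulop g \o mulop w =1 id /\ mulop w \o mulop g =1 id.
Proof.
move=> wg; have e : bmul w g = bcst 1 by apply: bfun_ext.
by split=> phi /=; last rewrite mulopC; rewrite mulopC -mulopM e mulop1.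
Qed.

Section Tuple.
Variables (m : nat) (z : 'I_m -> bfun).

Definition bexp (g : bfun) n : bfun := iter n (bmul g) (bcst 1).

Lemma bexpE (g : bfun) n y : bexp g n y = g y ^+ n.
Proof. by elim: n => [|n IH]; rewrite ?expr0 //= exprS -IH. Qed.

Lemma mulop_bexp g n phi : mulop (bexp g n) phi = iter n (mulop g) phi.
Proof. by elim: n => [|n IH]; rewrite ?mulop1 //= mulopM IH. Qed.

Definition bmono (mm : 'X_{1..m}) : bfun :=
  foldr (fun i f => bmul (bexp (z i) (mm i)) f) (bcst 1) (enum 'I_m).

Lemma bmonoE mm y : bmono mm y = \prod_i z i y ^+ mm i.
Proof.
rewrite /bmono -big_enum /=; elim: (enum 'I_m) => [|i s IH] /=; first by rewrite big_nil.
by rewrite big_cons IH bexpE.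
Qed.

Lemma mulop_bmono mm phi : mulop (bmono mm) phi = mono_op (fun i => mulop (z i)) mm phi.
Proof.
rewrite /bmono /mono_op; elim: (enum 'I_m) => [|i s IH] /=; first by rewrite mulop1.
by rewrite mulopM IH mulop_bexp.
Qed.

(** It repeats the sum that defines [mpoly_op], so that [mulop] carries one to the other term by
    term. *)
Definition beval (p : {mpoly C[m]}) : bfun := \sum_(mm <- msupp p) p@_mm *: bmono mm.

Lemma bevalE p y : beval p y = p.@[fun i => z i y].
Proof.
rewrite mevalE /beval; elim: (msupp p) => [|mm s IH]; first by rewrite !big_nil.
by rewrite !big_cons bfunZD IH bmonoE.
Qed.

Lemma mulop_beval p phi : mulop (beval p) phi = mpoly_op (fun i => mulop (z i)) p phi.
Proof.
rewrite /beval /mpoly_op; elim: (msupp p) => [|mm s IH].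
  by rewrite !big_nil mulop0.
by rewrite !big_cons mulop_lin IH mulop_bmono.
Qed.
End Tuple.
End GNS.
End BoundedFunctions.

(** * Complete positivity from scalar contractivity *)

Definition dot (y x : 'cV[C]_2) : C := \sum_i (y i 0)^* * x i 0.

Lemma dotDr y x x' : dot y (x + x') = dot y x + dot y x'.
Proof. by rewrite /dot -big_split; apply: eq_bigr => i _; rewrite mxE mulrDr. Qed.

Lemma dotZr a y x : dot y (a *: x) = a * dot y x.
Proof. by rewrite /dot mulr_sumr; apply: eq_bigr => i _; rewrite mxE mulrCA. Qed.

Lemma dot_conj y x : dot y x = (dot x y)^*.
Proof. by rewrite /dot conjc_sum; apply: eq_bigr => i _; rewrite conjcM conjcK mulrC. Qed.

Lemma dotDl y y' x : dot (y + y') x = dot y x + dot y' x.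
Proof. by rewrite dot_conj dotDr conjcD -!dot_conj. Qed.

Lemma dotZl a y x : dot (a *: y) x = a^* * dot y x.
Proof. by rewrite dot_conj dotZr conjcM -!dot_conj. Qed.

Lemma dot_adj (A : 'M[C]_2) y x : dot y (A *m x) = dot (adjmx A *m y) x.
Proof.
rewrite /dot; under eq_bigr do rewrite mxE mulr_sumr.
rewrite exchange_big; apply: eq_bigr => j _ /=.
rewrite mxE conjc_sum mulr_suml; apply: eq_bigr => i _.
by rewrite !mxE conjcM conjcK mulrCA mulrA.
Qed.

Lemma adjmxK A : adjmx (adjmx A) = A.
Proof. by apply/matrixP => i j; rewrite !mxE conjcK. Qed.

Lemma dot_ge0 x : 0 <= dot x x.
Proof. by apply: sumr_ge0 => i _; rewrite mulrC mulc_conj ler0c sqr_ge0. Qed.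

Lemma dot_gt0 x : x != 0 -> 0 < Re (dot x x).
Proof.
move=> x0; have := dot_ge0 x; rewrite lecE => /andP[/eqP im re].
rewrite lt_def re andbT; apply: contra x0 => /eqP re0.
have d0 : dot x x = 0 by apply: complex_ext.
apply/eqP/matrixP => i j; rewrite ord1 mxE; apply/eqP.
move/eqP: d0; rewrite psumr_eq0; last first.
  by move=> k _; rewrite mulrC mulc_conj ler0c sqr_ge0.
move=> /allP/(_ i (mem_index_enum _)) /=.
by rewrite mulf_eq0 conjc_eq0 orbb.
Qed.

Lemma unitmx_inj (A : 'M[C]_2) : (forall x : 'cV_2, A *m x = 0 -> x = 0) -> A \in unitmx.
Proof.
move=> h; rewrite -unitmx_tr -row_free_unit -kermx_eq0.
apply/eqP/row_matrixP => i; rewrite row0; apply: trmx_inj; rewrite trmx0; apply: h.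
by rewrite -[A]trmxK -trmx_mul trmxK -row_mul mulmx_ker row0 trmx0.
Qed.

(** * Function algebras with a derivation between two points *)

Section Positivity.
Variables (Z : Type) (a b : Z) (D : (Z -> C) -> C -> Prop).
Hypothesis D_cst : forall c, D (fun=> c) 0.
Hypothesis D_add : forall f d g e, D f d -> D g e -> D (fun z => f z + g z) (d + e).
Hypothesis D_mul : forall f d g e, D f d -> D g e ->
  D (fun z => f z * g z) (f a * e + d * g b).
Hypothesis D_inv : forall f d, (forall z, f z != 0) -> D f d ->
  exists e, D (fun z => (f z)^-1) e.
Hypothesis D_contr : forall f d (c : R), D f d -> f a = 0 -> 0 <= c ->
  (forall z, normc (f z) ^+ 2 <= c) -> normc d ^+ 2 + normc (f b) ^+ 2 <= c.

Lemma D_scale c f d : D f d -> D (fun z => c * f z) (c * d).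
Proof. by move=> /(D_mul (D_cst c)); rewrite mul0r addr0. Qed.

(** If f has the corners d and e, then the zero function has the corner d - e, and contractivity
    with bound 0 makes it vanish. *)
Lemma D_unique f d e : D f d -> D f e -> d = e.
Proof.
move=> fd /(D_scale (-1)) /(D_add fd).
have -> : (fun z => f z + -1 * f z) = (fun=> 0) by apply/funext => z; rewrite mulN1r subrr.
move=> /D_contr /(_ erefl (lexx 0)); rewrite normc0 expr0n addr0 => /(_ (fun=> lexx 0)).
rewrite mulN1r => h; apply/eqP; rewrite -subr_eq0 -normc_eq0 -sqrf_eq0.
by rewrite eq_le h sqr_ge0.
Qed.

Lemma D_sum (I : Type) (s : seq I) (f : I -> Z -> C) (d : I -> C) :
  (forall i, D (f i) (d i)) -> D (fun z => \sum_(i <- s) f i z) (\sum_(i <- s) d i).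
Proof.
move=> fd; elim: s => [|i s IH].
  by under eq_fun do rewrite big_nil; rewrite big_nil; exact: D_cst.
by under eq_fun do rewrite big_cons; rewrite big_cons; exact: D_add.
Qed.

Lemma D_prod (I : Type) (s : seq I) (f : I -> Z -> C) :
  (forall i, exists d, D (f i) d) -> exists d, D (fun z => \prod_(i <- s) f i z) d.
Proof.
move=> fd; elim: s => [|i s [e IH]].
  by exists 0; under eq_fun do rewrite big_nil; exact: D_cst.
by have [d hd] := fd i; eexists; under eq_fun do rewrite big_cons; exact: D_mul hd IH.
Qed.

Lemma D_det n (F : Z -> 'M[C]_n) :
  (forall i j, exists d, D (fun z => F z i j) d) -> exists d, D (fun z => \det (F z)) d.
Proof.
move=> FD.
have H (s : 'S_n) : exists d, D (fun z => (-1) ^+ s * \prod_i F z i (s i)) d.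
  have [d hd] := @D_prod _ (index_enum _) (fun i z => F z i (s i)) (fun i => FD i (s i)).
  by exists ((-1) ^+ s * d); exact: D_scale.
have [d hd] := choice H; eexists.
exact: (@D_sum _ (index_enum _) _ d).
Qed.

(** By the cofactor formula the entries of the inverse stay in the algebra. Only the existence of
    their corners matters: where they are used, they are multiplied by entries of [N a] = 0. *)
Lemma D_invmx n (F : Z -> 'M[C]_n) :
  (forall i j, exists d, D (fun z => F z i j) d) -> (forall z, F z \in unitmx) ->
  forall i j, exists d, D (fun z => invmx (F z) i j) d.
Proof.
move=> FD Fu i j.
have e z : invmx (F z) i j = (\det (F z))^-1 * ((-1) ^+ (j + i) * \det (row' j (col' i (F z)))).
  by rewrite /invmx Fu !mxE.
have [d hd] := D_det FD.
have [d' hd'] : exists d, D (fun z => \det (row' j (col' i (F z)))) d.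
  apply: D_det => k l; have [d'' h] := FD (lift j k) (lift i l); exists d''.
  by under eq_fun do rewrite !mxE.
have [|d1 hd1] := D_inv _ hd; first by move=> z; have := Fu z; rewrite unitmxE unitfE.
eexists; under eq_fun do rewrite e.
exact: D_mul hd1 (D_scale _ hd').
Qed.

Section Strict.
Variables (F : Z -> 'M[C]_2) (dF : 'M[C]_2) (w1 w2 : 'cV[C]_2).
Hypothesis FD : forall i j, D (fun z => F z i j) (dF i j).
Hypothesis F_ge0 : forall z x, 0 <= Re (dot x (F z *m x)).
Hypothesis Fa_gt0 : forall x, x != 0 -> 0 < Re (dot x (F a *m x)).

(** With H the Hermitian part of F(a) and N = F - F(a), the matrix 2H + N(z) equals F(z) + F(a)^*.
    So N (2H + N)^-1 is the Cayley transform of F based at a; it vanishes at a, where [D_contr]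
    applies. *)
Let H : 'M[C]_2 := 2^-1 *: (F a + adjmx (F a)).
Let N z : 'M[C]_2 := F z - F a.

Lemma herm_adj y x : dot y (H *m x) = dot (H *m y) x.
Proof.
rewrite /H -!scalemxAl dotZr dotZl !mulmxDl dotDr dotDl !dot_adj adjmxK addrC.
by rewrite conjc_inv conjc_nat.
Qed.

Lemma herm_Re x : dot x (H *m x) = (Re (dot x (F a *m x)))%:C.
Proof.
rewrite /H -scalemxAl dotZr mulmxDl dotDr [dot x (adjmx _ *m x)]dot_adj adjmxK.
rewrite [dot (_ *m _) x]dot_conj ReJ_add mulrC; congr (_ * _).
Qed.

Definition herm_inner : semi_inner 'cV[C]_2.
Proof.
exists (fun x y => dot y (H *m x)).
- by move=> c x y z; rewrite mulmxDr -scalemxAr dotDr dotZr.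
- by move=> x y; rewrite herm_adj dot_conj.
- by move=> x; rewrite herm_Re ler0c F_ge0.
Defined.

Lemma herm_unit : H \in unitmx.
Proof.
apply: unitmx_inj => x Hx; apply/eqP; apply: contraT => /Fa_gt0.
by rewrite -ltcR -herm_Re Hx /dot big1 ?ltxx // => i _; rewrite mxE mulr0.
Qed.

Lemma ReN2H z x : Re (dot x ((2 *: H + N z) *m x)) =
  Re (dot x (F a *m x)) + Re (dot x (F z *m x)).
Proof.
rewrite /N addrA mulmxBl mulmxDl -scalemxAl dotDr -scaleN1r dotZr dotDr dotZr herm_Re.
by rewrite mulN1r ReB ReD -(rmorph_nat (real_complex R)) ReZ /=; lra.
Qed.

Lemma N2H_unit z : 2 *: H + N z \in unitmx.
Proof.
apply: unitmx_inj => x Hx; apply/eqP; apply: contraT => /Fa_gt0.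
have := ReN2H z x; rewrite Hx.
have -> : dot x 0 = 0 by rewrite /dot big1 // => i _; rewrite mxE mulr0.
by have := F_ge0 z x; rewrite /=; lra.
Qed.

(** Let y = H^-1 v with v = dF w2. The H-square of w1 + y/2 equals Re <F(a) w1, w1> + Re <v, w1> +
    |y|_H^2 / 4, so it suffices that |y|_H^2 <= 4 Re <F(b) w2, w2>. Contractivity for the scalar
    function [g] below supplies this inequality. *)
Lemma positivity_strict :
  0 <= Re (dot w1 (F a *m w1) + dot w1 (dF *m w2) + dot w2 (F b *m w2)).
Proof.
set v := dF *m w2; set u := N b *m w2.
have Fb : dot w2 (F b *m w2) = dot w2 (F a *m w2) + dot w2 u.
  by rewrite /u -dotDr -mulmxDl /N addrC subrK.
have [v0|vn0] := eqVneq v 0.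
  rewrite v0; have -> : dot w1 0 = 0 by rewrite /dot big1 // => i _; rewrite mxE mulr0.
  by rewrite addr0 ReD addr_ge0.
have ND i j : D (fun z => N z i j) (dF i j).
  have := D_add (FD i j) (D_cst (- F a i j)); rewrite addr0.
  by congr D; apply/funext => z; rewrite !mxE.
have fD i : D (fun z => (N z *m w2) i 0) (v i 0).
  have -> : (fun z => (N z *m w2) i 0) = fun z => \sum_j w2 j 0 * N z i j.
    by apply/funext => z; rewrite mxE; apply: eq_bigr => j _; rewrite mulrC.
  rewrite mxE; under eq_bigr do rewrite mulrC.
  by apply: (@D_sum _ _ (fun j z => w2 j 0 * N z i j)) => j; exact: D_scale (ND i j).
have Na0 : N a = 0 by rewrite /N subrr.
(* Entry i of N w2 vanishes at a, so the product of entries i and j has corner v_i u_j; the product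
   is symmetric in i and j and its corner is unique. *)
have uv i j : v i 0 * u j 0 = v j 0 * u i 0.
  have := D_mul (fD i) (fD j); have := D_mul (fD j) (fD i).
  rewrite Na0 !mul0mx !mxE !mul0r !add0r -/u.
  have -> : (fun z => (N z *m w2) j 0 * (N z *m w2) i 0) =
     fun z => (N z *m w2) i 0 * (N z *m w2) j 0 by apply/funext => z; rewrite mulrC.
  by move=> h1 h2; exact: D_unique h2 h1.
have [i0 vi0] : exists i, v i 0 != 0.
  apply: contrapT => nv; move/eqP: vn0; apply; apply/matrixP => i j.
  by rewrite ord1 [RHS]mxE; apply/eqP; apply: contraT => h; case: nv; exists i.
have [k uk] : exists k, u = k *: v.
  exists (u i0 0 / v i0 0).
  by apply/matrixP => i j; rewrite ord1 [RHS]mxE mulrAC [_ * v i 0]mulrC uv [v i0 0 * _]mulrC mulfK.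
have [y Hy] : exists y, H *m y = v by exists (invmx H *m v); rewrite mulKVmx ?herm_unit.
pose h := herm_inner.
have sqh x : sqn h x = Re (dot x (F a *m x)) by rewrite /sqn /= herm_Re.
(* Chosen so that H p = (2H + N(b)) w2; the solution c of (2H + N) c = H p then takes the value w2
   at b. *)
pose p := 2 *: w2 + k *: y.
have Hp : H *m p = (2 *: H + N b) *m w2.
  by rewrite /p mulmxDr -!scalemxAr Hy -uk mulmxDl -scalemxAl.
pose c z := invmx (2 *: H + N z) *m (H *m p).
have cb : c b = w2 by rewrite /c Hp mulKmx ?N2H_unit.
have [dc hdc] : exists dc : 'I_2 -> C, forall j, D (fun z => c z j 0) (dc j).
  suff H1 j : exists d, D (fun z => c z j 0) d by have [dc ?] := choice H1; exists dc.
  have H2 l : exists d, D (fun z => (H *m p) l 0 * invmx (2 *: H + N z) j l) d.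
    have [|z|d hd] := @D_invmx 2 (fun z => 2 *: H + N z) _ _ j l.
    - move=> i i'; exists (0 + dF i i').
      have := D_add (D_cst ((2 *: H) i i')) (ND i i').
      by congr D; apply/funext => z; rewrite [RHS]mxE.
    - exact: N2H_unit.
    - by exists ((H *m p) l 0 * d); exact: D_scale.
  have [d hd] := choice H2; exists (\sum_l d l).
  have := D_sum (index_enum _) hd; congr D; apply/funext => z.
  by rewrite [RHS]mxE; apply: eq_bigr => l _; rewrite mulrC.
(* The Cayley transform applied to H p and paired with y. Its corner is <v, y> = |y|_H^2, the
   derivative of c being multiplied by N(a) = 0, and its value at b is k |y|_H^2. *)
pose g z := dot y (N z *m c z).
have gD : D g (dot y v).
  have -> : g = fun z => \sum_i \sum_j (y i 0)^* * (N z i j * c z j 0).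
    apply/funext => z; rewrite /g /dot; apply: eq_bigr => i _.
    by rewrite mxE mulr_sumr.
  have -> : dot y v = \sum_i \sum_j (y i 0)^* * (N a i j * dc j + dF i j * c b j 0).
    rewrite /dot; apply: eq_bigr => i _; rewrite /v mxE mulr_sumr; apply: eq_bigr => j _.
    by rewrite Na0 mxE mul0r add0r cb.
  apply: (@D_sum _ _ (fun i z => \sum_j (y i 0)^* * (N z i j * c z j 0))) => i.
  apply: (@D_sum _ _ (fun j z => (y i 0)^* * (N z i j * c z j 0))) => j.
  exact: D_scale (D_mul (ND i j) (hdc j)).
have ga : g a = 0.
  by rewrite /g Na0 mul0mx /dot big1 // => i _; rewrite mxE mulr0.
have gb : g b = dot y u by rewrite /g cb.
(* The Cayley estimate: N c = H (p - 2c), and |p - 2c|_H^2 = |p|_H^2 - 4 Re <F c, c> <= |p|_H^2. *)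
have gle z : normc (g z) ^+ 2 <= sqn h p * sqn h y.
  have Hc : 2 *: (H *m c z) + N z *m c z = H *m p.
    by rewrite scalemxAl -mulmxDl /c mulKVmx ?N2H_unit.
  have Nc : N z *m c z = H *m (p - 2 *: c z).
    by rewrite mulmxBr -scalemxAr -Hc addrC addKr.
  have -> : g z = h (p - 2 *: c z) y by rewrite /g Nc.
  apply: le_trans (h_CauchySchwarz _ _ _) _.
  rewrite ler_wpM2r ?sqn_ge0 //.
  suff -> : sqn h (p - 2 *: c z) = sqn h p - 4 * Re (dot (c z) (F z *m c z)).
    by have := F_ge0 z (c z); lra.
  have cFc : Re (dot (c z) (F z *m c z)) = Re (h p (c z)) - sqn h (c z).
    have := ReN2H z (c z); rewrite mulmxDl -scalemxAl Hc.
    by rewrite /sqn /h /= herm_Re /=; lra.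
  rewrite cFc /sqn hBl !hBr !hZl !hZr [h (c z) p]sform_conj conjc_nat.
  rewrite !ReB -!(rmorph_nat (real_complex R)) !ReZ Re_conjc.
  by ring.
have main := D_contr gD ga (mulr_ge0 (sqn_ge0 h p) (sqn_ge0 h y)) gle.
have s0 : 0 < sqn h y.
  rewrite /sqn /= herm_Re /=; apply: Fa_gt0; apply: contra vn0 => /eqP y0.
  by rewrite -Hy y0 mulmx0.
have dyv : dot y v = (sqn h y)%:C by rewrite -sqnE /= Hy.
have : (1 + normc k ^+ 2) * sqn h y <= sqn h p.
  rewrite -(ler_pM2r s0); apply: le_trans main; rewrite gb uk dotZr normcM dyv normc_real.
  by rewrite exprMn real_normK ?num_real //; lra.
(* The terms |k|^2 |y|_H^2 on both sides of the preceding inequality now cancel. *)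
have -> : sqn h p = 4 * (Re (dot w2 (F b *m w2))) + normc k ^+ 2 * sqn h y.
  have -> : sqn h p = Re (4 * h w2 w2 + 2 * (h (k *: y) w2 + (h (k *: y) w2)^*)
                          + (k * k^*) * h y y).
    rewrite /sqn /p hDl !hDr !hZl !hZr conjc_nat [h w2 y]sform_conj conjcM.
    by congr Re; ring.
  have -> : h (k *: y) w2 = dot w2 u by rewrite /= -scalemxAr Hy uk.
  rewrite addcJ mulc_conj sqnE -!(rmorph_nat (real_complex R)) !ReD -!rmorphM ReZ.
  by rewrite /= herm_Re Fb ReD /= !sqh; ring.
move=> hp.
have : 0 <= sqn h (w1 + 2^-1 *: y) by apply: sqn_ge0.
have -> : sqn h (w1 + 2^-1 *: y) = Re (dot w1 (F a *m w1)) + Re (dot w1 v) + sqn h y / 4.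
  have -> : sqn h (w1 + 2^-1 *: y) =
     Re (h w1 w1 + 2^-1 * (h y w1 + (h y w1)^*) + 4^-1 * h y y).
    rewrite /sqn hDl !hDr !hZl !hZr conjc_inv conjc_nat [h w1 y]sform_conj.
    by congr Re; field.
  have -> : h y w1 = dot w1 v by rewrite /= Hy.
  rewrite addcJ mulKf ?pnatr_eq0 // !ReD !sqnE !sqh.
  by rewrite -(rmorph_nat (real_complex R)) -fmorphV -rmorphM /=; field.
by rewrite !ReD; lra.
Qed.
End Strict.

(** Adding e to F makes the real part strictly positive at a and changes the conclusion by e (|w1|^2
    + |w2|^2), with e arbitrarily small. *)
Lemma positivity (F : Z -> 'M[C]_2) (dF : 'M[C]_2) (w1 w2 : 'cV[C]_2) :
  (forall i j, D (fun z => F z i j) (dF i j)) ->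
  (forall z x, 0 <= Re (dot x (F z *m x))) ->
  0 <= Re (dot w1 (F a *m w1) + dot w1 (dF *m w2) + dot w2 (F b *m w2)).
Proof.
move=> FD F0.
pose S := Re (dot w1 w1) + Re (dot w2 w2).
have dot0 x : 0 <= Re (dot x x).
  by have := dot_ge0 x; rewrite lecE => /andP[].
have pE (e : R) z x : Re (dot x ((F z + e%:C%:M) *m x)) = Re (dot x (F z *m x)) + e * Re (dot x x).
  by rewrite mulmxDl mul_scalar_mx dotDr dotZr ReD ReZ.
have key (e : R) : 0 < e ->
    0 <= Re (dot w1 (F a *m w1) + dot w1 (dF *m w2) + dot w2 (F b *m w2)) + e * S.
  move=> e0.
  have := @positivity_strict (fun z => F z + e%:C%:M) dF w1 w2 _ _ _.
  rewrite !ReD !pE /S mulrDr => H; suff : 0 <=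
    Re (dot w1 (F a *m w1)) + e * Re (dot w1 w1) + Re (dot w1 (dF *m w2)) +
    (Re (dot w2 (F b *m w2)) + e * Re (dot w2 w2)) by lra.
  apply: H.
  - move=> i j; have := D_add (FD i j) (D_cst ((e%:C%:M : 'M_2) i j)); rewrite addr0.
    by congr D; apply/funext => z; rewrite [RHS]mxE.
  - by move=> z x; rewrite pE addr_ge0 ?F0 // mulr_ge0 ?dot0 ?ltW.
  - move=> x x0; rewrite pE; have := mulr_gt0 e0 (dot_gt0 x0); have := F0 a x; lra.
have S0 : 0 <= S by rewrite addr_ge0.
apply/ler_addgt0Pr => d d0.
have S1 : 0 < S + 1 by lra.
have := key (d / (S + 1)) (divr_gt0 d0 S1).
have : d / (S + 1) * S <= d.
  by rewrite mulrAC ler_pdivrMr // ler_pM2l //; lra.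
lra.
Qed.
End Positivity.

(** * Maximum principle on the annulus *)

Lemma in_cl_annulusE (r : R) z : in_cl_annulus r z = (r <= normc z <= 1).
Proof. by rewrite /in_cl_annulus normC_normc lecR -(lecR (normc z)). Qed.

Lemma in_bd_annulusE (r : R) z : in_bd_annulus r z = (normc z == r) || (normc z == 1).
Proof.
rewrite /in_bd_annulus normC_normc (inj_eq (@complexI _)).
by rewrite -(rmorph1 (real_complex R)) (inj_eq (@complexI _)).
Qed.

Lemma bd_cl_annulus (r : R) z : 0 < r < 1 -> in_bd_annulus r z -> in_cl_annulus r z.
Proof.
rewrite in_bd_annulusE in_cl_annulusE => /andP[r0 r1].
by case/orP => /eqP ->; apply/andP; split; lra.
Qed.

Lemma ulim_cl_annulus (r : R) u l :
  (forall n, in_cl_annulus r (u n)) -> ulim u l -> in_cl_annulus r l.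
Proof.
move=> ua ul; rewrite in_cl_annulusE; apply/andP; split.
  by apply: ulim_normc_ge ul _ => n; have := ua n; rewrite in_cl_annulusE => /andP[].
by apply: ulim_normc_le ul _ => n; have := ua n; rewrite in_cl_annulusE => /andP[].
Qed.

Lemma cl_annulus_ulim_exists (r : R) u :
  (forall n, in_cl_annulus r (u n)) -> exists l, ulim u l.
Proof.
move=> ua; apply: (@ulim_bounded _ 1) => n.
by have := ua n; rewrite in_cl_annulusE => /andP[].
Qed.

Lemma ulimV u l : l != 0 -> ulim u l -> ulim (fun n => (u n)^-1) l^-1.
Proof.
move=> l0 ul e e0; have nl : 0 < normc l by rewrite normc_gt0.
have nl2 : 0 < normc l / 2 by lra.
have d0 : 0 < e * (normc l ^+ 2 / 2) by rewrite mulr_gt0 // divr_gt0 ?exprn_gt0.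
apply: filterS (filterI (ul _ nl2) (ul _ d0)) => n [/= h1 h2].
have h3 : normc l / 2 < normc (u n).
  by have := normcD (u n) (- (u n - l)); rewrite opprB addrC subrK normcB; lra.
have un0 : u n != 0 by rewrite -normc_gt0; lra.
have -> : (u n)^-1 - l^-1 = (l - u n) / (u n * l) by field; rewrite un0 l0.
rewrite normcM normcV normcM ltr_pdivrMr; last by rewrite mulr_gt0 //; lra.
rewrite normcB; apply: lt_le_trans h2 _; rewrite ler_pM2l // expr2 mulrAC.
by rewrite ler_pM2r // ltW.
Qed.

Lemma ulim_horner (p : {poly C}) u l : ulim u l -> ulim (fun n => p.[u n]) p.[l].
Proof.
move=> ul; rewrite horner_coef; under eq_fun do rewrite horner_coef.
by apply: (@ulim_sum _ _ (fun (i : 'I__) n => p`_i * u n ^+ i)) => i; apply: ulimM (ulim_cst _) (ulimX _ ul).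
Qed.

Lemma ulim_Re_ge u l (M : R) : ulim u l -> (forall n, M <= Re (u n)) -> M <= Re l.
Proof.
move=> /ulimN ul uM; rewrite -lerN2.
have := @ulim_Re_le _ _ (- M) ul; case: l {ul} => x y; apply=> n.
by have := uM n; case: (u n) => x' y' /=; rewrite lerN2.
Qed.

Lemma ulim_invSn : ulim (fun n => (n.+1%:R^-1 : R)%:C) 0.
Proof.
apply: (@ulim_close (fun=> 0) _ _ 1); last exact: ulim_cst.
move=> n; rewrite sub0r normcN normc_real ger0_norm ?invSn_ge0 // mul1r.
by rewrite expr2 ler_piMr ?invSn_ge0 // invSn_le1.
Qed.

Section OneVariable.
Variables (r : R) (p q : {poly C}).
Hypothesis r01 : 0 < r < 1.
Hypothesis q0 : forall z, in_cl_annulus r z -> q.[z] != 0.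

Let f z := p.[z] / q.[z].

Lemma ulim_rational u l : (forall n, in_cl_annulus r (u n)) -> ulim u l ->
  ulim (fun n => f (u n)) (f l).
Proof.
move=> ua ul; apply: ulimM (ulim_horner _ ul) _.
by apply: ulimV (ulim_horner _ ul); apply: q0 (ulim_cl_annulus ua ul).
Qed.

(** Ultralimits of points of the annulus stay in it. A sequence with unbounded values contradicts
    continuity at its limit, and the limit of a maximising sequence attains the supremum. *)
Lemma rational_max : exists2 z, in_cl_annulus r z &
  forall w, in_cl_annulus r w -> Re (f w) <= Re (f z).
Proof.
pose S : set R := [set Re (f z) | z in [set z | in_cl_annulus r z]]%classic.
have S1 : in_cl_annulus r 1.
  by apply: bd_cl_annulus => //; rewrite in_bd_annulusE normc_real normr1 eqxx orbT.
have hS : has_sup S.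
  split; first by exists (Re (f 1)), 1.
  apply: contrapT => nS.
  have H n : exists z, in_cl_annulus r z /\ n%:R <= Re (f z).
    apply: contrapT => nz; apply: nS; exists n%:R => _ [z az <-].
    by rewrite leNgt; apply/negP => /ltW h; apply: nz; exists z.
  have [u hu] := choice H.
  have ua n : in_cl_annulus r (u n) by have [] := hu n.
  have [l ul] := cl_annulus_ulim_exists ua.
  have fl := ulim_rational ua ul.
  have [n [/= h1 h2]] := fuf_ex2 (fl _ ltr01) (fuf_tail (Num.trunc `|Re (f l) + 1|).+1).
  have := normc_Re (f (u n) - f l); rewrite ReB => /le_lt_trans/(_ h1).
  rewrite ltr_norml => /andP[_ h3]; have [_ h4] := hu n.
  have : `|Re (f l) + 1| < n%:R.
    by apply: lt_le_trans (truncnS_gt _) _; rewrite ler_nat.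
  by have := ler_norm (Re (f l) + 1); lra.
have H n : exists z, in_cl_annulus r z /\ sup S - n.+1%:R^-1 <= Re (f z).
  have [|_ [z az <-] h] := @sup_adherent _ S n.+1%:R^-1 _ hS.
    by rewrite invr_gt0 ltr0Sn.
  by exists z; split=> //; exact: ltW.
have [u hu] := choice H.
have ua n : in_cl_annulus r (u n) by have [] := hu n.
have [l ul] := cl_annulus_ulim_exists ua.
exists l; first exact: ulim_cl_annulus ua ul.
move=> w aw; apply: (@le_trans _ _ (sup S)).
  by apply: (ub_le_sup (proj2 hS)); exists w.
have := ulimD (ulim_rational ua ul) ulim_invSn; rewrite addr0 => /ulim_Re_ge; apply=> n.
by rewrite ReD -lerBlDr; have [_] := hu n.
Qed.

(** Near z one has f(w) = f(z) + (w - z)^k g(w) with k > 0 and g(z) nonzero, so some direction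
    increases the real part. *)
Lemma rational_no_interior_max z : r < normc z < 1 -> p != (p.[z] / q.[z]) *: q ->
  exists2 w, in_cl_annulus r w & Re (f z) < Re (f w).
Proof.
move=> /andP[rz z1] npq.
have az : in_cl_annulus r z by rewrite in_cl_annulusE !ltW.
pose P := p - f z *: q.
have P0 : P != 0 by rewrite subr_eq0.
have Pz : root P z.
  by rewrite /root /P !hornerE /f divfK ?q0 // subrr.
have [k [h rh Ph]] := multiplicity_XsubC P z.
rewrite P0 /= in rh.
have k0 : (0 < k)%N.
  by case: k Ph => // Ph; move: rh; rewrite Ph expr0 mulr1 in Pz *; rewrite Pz.
pose g (w : C) : C := h.[w] / q.[w].
have fE (w : C) : in_cl_annulus r w -> f w = f z + (w - z) ^+ k * g w.
  move=> aw; have E : p.[w] - f z * q.[w] = h.[w] * (w - z) ^+ k.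
    have := congr1 (fun s : {poly C} => s.[w]) Ph; rewrite /P hornerD hornerN hornerZ => ->.
    by rewrite hornerM horner_exp hornerXsubC.
  by rewrite /g mulrA [_ * h.[w]]mulrC -E mulrBl mulfK ?q0 // addrC subrK.
have gz : g z != 0 by rewrite mulf_neq0 ?invr_eq0 ?q0.
(* Moving by t s, with t > 0 and s^k the conjugate of g(z), changes f by t^k (|g(z)|^2 + o(1)),
   whose real part is eventually positive. *)
pose s : C := k.-root (g z)^*.
have sk : s ^+ k = (g z)^* by rewrite rootCK.
pose u n : C := z + (n.+1%:R^-1 : R)%:C * s.
have uz : ulim u z.
  by have := ulimD (ulim_cst z) (ulimM ulim_invSn (ulim_cst s)); rewrite mul0r addr0.
have gu : ulim (fun n => g (u n)) (g z).
  by apply: ulimM (ulim_horner _ uz) (ulimV (q0 az) (ulim_horner _ uz)).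
have e0 : 0 < Num.min (normc z - r) (1 - normc z) by rewrite lt_min; apply/andP; split; lra.
have ng : 0 < normc (g z) by rewrite normc_gt0.
have [n [/= h1 h2]] := fuf_ex2 (uz _ e0) (gu _ ng).
have au : in_cl_annulus r (u n).
  move: h1; rewrite lt_min => /andP[h1 h1'].
  rewrite in_cl_annulusE; apply/andP; split.
    by have := normcD (u n) (z - u n); rewrite addrC subrK normcB; lra.
  by have := normcD z (u n - z); rewrite addrC subrK; lra.
exists (u n) => //; rewrite (fE _ au) ReD ltrDl.
have -> : (u n - z) ^+ k * g (u n) =
   (n.+1%:R^-1 ^+ k)%:C * (g z * (g z)^* + (g z)^* * (g (u n) - g z)).
  by rewrite /u addrC addKr exprMn sk rmorphXn; ring.
rewrite ReZ mulr_gt0 ?exprn_gt0 ?invr_gt0 ?ltr0Sn // ReD mulc_conj /=.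
have := normc_Re ((g z)^* * (g (u n) - g z)); rewrite normcM normc_conj.
have : normc (g z) * normc (g (u n) - g z) < normc (g z) ^+ 2.
  by rewrite expr2 ltr_pM2l.
by rewrite ler_norml => h3 /andP[h4 _]; lra.
Qed.

Lemma rational_max_principle w : in_cl_annulus r w ->
  exists2 z, in_bd_annulus r z & Re (f w) <= Re (f z).
Proof.
move=> aw; have [z az zmax] := rational_max.
have [bz|nbz] := boolP (in_bd_annulus r z); first by exists z => //; exact: zmax.
have bd1 : in_bd_annulus r 1 by rewrite in_bd_annulusE normc_real normr1 eqxx orbT.
have [pq|npq] := eqVneq p ((p.[z] / q.[z]) *: q).
  exists 1 => //; have cst x : in_cl_annulus r x -> f x = f z.
    by move=> ax; rewrite {1}/f {1}pq hornerZ mulfK ?q0.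
  by rewrite (cst _ aw) (cst 1) // bd_cl_annulus.
have [|x ax] := @rational_no_interior_max z _ npq.
  move: az nbz; rewrite in_cl_annulusE in_bd_annulusE negb_or => /andP[h1 h2] /andP[h3 h4].
  by rewrite !lt_neqAle h1 h2 h4 eq_sym h3.
by rewrite ltNge zmax.
Qed.
End OneVariable.

(** * Slices of polynomials and the closed polyannulus *)

Section Slice.
Variables (m : nat) (w : 'I_m -> C) (k : 'I_m).

Definition slice (p : {mpoly C[m]}) : {poly C} :=
  mmap (@polyC C) (fun i => if i == k then 'X else (w i)%:P) p.

Lemma slice_horner p x : (slice p).[x] = p.@[fun i => if i == k then x else w i].
Proof.
rewrite /slice /mmap mevalE horner_sum; apply: eq_bigr => mm _.
rewrite hornerM hornerC /mmap1 horner_prod; congr (_ * _); apply: eq_bigr => i _.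
by rewrite horner_exp; case: eqP => _; rewrite ?hornerX ?hornerC.
Qed.

(** When all members but one are scalar, a polynomial in the tuple is a polynomial in the remaining
    matrix, so contractivity of that matrix controls functions of m variables. *)
Lemma slice_mx (B : 'I_m -> 'M[C]_2) p : (forall i, i != k -> B i = (w i)%:M) ->
  mpoly_mx B p = horner_mx (B k) (slice p).
Proof.
move=> Bw; rewrite /mpoly_mx /slice /mmap rmorph_sum; apply: eq_bigr => mm _ /=.
rewrite rmorphM /= horner_mx_C -mul_scalar_mx; congr (_ *m _).
rewrite /mmap1 rmorph_prod; apply: eq_bigr => i _ /=; rewrite rmorphXn /=.
have [->|ik] := eqVneq i k; first by rewrite horner_mx_X.
by rewrite horner_mx_C Bw.
Qed.
End Slice.

Lemma meval_eq m (z z' : 'I_m -> C) (p : {mpoly C[m]}) :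
  (forall i, z i = z' i) -> p.@[z] = p.@[z'].
Proof. by move=> e; congr meval; apply/funext. Qed.

Lemma ulim_meval m (p : {mpoly C[m]}) (u : nat -> 'I_m -> C) (l : 'I_m -> C) :
  (forall i, ulim (fun n => u n i) (l i)) -> ulim (fun n => p.@[u n]) p.@[l].
Proof.
move=> ul; rewrite mevalE; under eq_fun do rewrite mevalE.
apply: (@ulim_sum _ _ (fun mm n => p@_mm * \prod_i u n i ^+ mm i)) => mm.
apply: ulimM (ulim_cst _) _.
by apply: (@ulim_prod _ _ (fun i n => u n i ^+ mm i)) => i; exact: ulimX.
Qed.

Section ManyVariables.
Variables (r : R) (m : nat).
Hypothesis r01 : 0 < r < 1.
Variables (p q : {mpoly C[m]}).
Hypothesis q0 : forall z : 'I_m -> C, (forall i, in_cl_annulus r (z i)) -> q.@[z] != 0.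

(** The coordinates are pushed to the boundary circles one at a time; each move applies the
    one-variable principle to a slice and does not lower the real part. *)
Lemma polyannulus_max_principle (w : 'I_m -> C) : (forall i, in_cl_annulus r (w i)) ->
  exists2 z, (forall i, in_bd_annulus r (z i)) &
    Re (p.@[w] / q.@[w]) <= Re (p.@[z] / q.@[z]).
Proof.
move=> aw.
suff H (s : seq 'I_m) : exists z, [/\ forall i, in_cl_annulus r (z i),
    forall i, i \in s -> in_bd_annulus r (z i) &
    Re (p.@[w] / q.@[w]) <= Re (p.@[z] / q.@[z])].
  have [z [_ bz le]] := H (enum 'I_m).
  by exists z => // i; apply: bz; rewrite mem_enum.
elim: s => [|k s [z [az bz le]]]; first by exists w; split.
pose zk x i := if i == k then x else z i.
have azk x : in_cl_annulus r x -> forall i, in_cl_annulus r (zk x i).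
  by move=> ax i; rewrite /zk; case: ifP.
have [|x bx] := @rational_max_principle r (slice z k p) (slice z k q) r01 _ (z k) (az k).
  by move=> x ax; rewrite slice_horner; apply: q0; exact: azk.
rewrite !slice_horner.
have e (p' : {mpoly C[m]}) : p'.@[zk (z k)] = p'.@[z].
  by apply: meval_eq => i; rewrite /zk; case: eqP => [->|].
rewrite -!/(zk _) !e => le'.
exists (zk x); split; last exact: le_trans le le'.
- by apply: azk; exact: bd_cl_annulus.
- move=> i; rewrite inE /zk; case: eqP => //= _; exact: bz.
Qed.

(** Needed so that 1/q is a bounded function and multiplication by it a bounded operator. Points
    where q tends to 0 would have a coordinatewise ultralimit at which q vanishes. *)
Lemma meval_lower_bound : exists2 d : R, 0 < d &
  forall z : 'I_m -> C, (forall i, in_cl_annulus r (z i)) -> d <= normc q.@[z].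
Proof.
apply: contrapT => nd.
have H n : exists z : 'I_m -> C, (forall i, in_cl_annulus r (z i)) /\
    normc q.@[z] <= n.+1%:R^-1.
  apply: contrapT => nz; apply: nd; exists n.+1%:R^-1; first by rewrite invr_gt0 ltr0Sn.
  by move=> z az; rewrite leNgt; apply/negP => /ltW h; apply: nz; exists z.
have [u hu] := choice H.
have L i : exists l, ulim (fun n => u n i) l.
  by apply: (@cl_annulus_ulim_exists r) => n; have [] := hu n.
have [l hl] := choice L.
have al i : in_cl_annulus r (l i).
  by apply: ulim_cl_annulus (hl i) => n; have [] := hu n.
have : q.@[l] = 0.
  apply: ulim_unique (ulim_meval q hl) _.
  apply: (@ulim_close (fun=> 0) _ _ 1); last exact: ulim_cst.
  move=> n; rewrite sub0r normcN mul1r; have [_ h] := hu n.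
  apply: (@le_trans _ _ (n.+1%:R^-1 ^+ 2)).
    by rewrite ler_pXn2r ?nnegrE ?normc_ge0 ?invSn_ge0.
  by rewrite expr2 ler_piMr ?invSn_ge0 // invSn_le1.
by move/eqP; apply/negP; exact: q0.
Qed.
End ManyVariables.

(** * Lower triangular commuting tuples *)

Lemma mpoly_mxE m (B : 'I_m -> 'M[C]_2) p : mpoly_mx B p = mmap (@scalar_mx C 2) B p.
Proof. by apply: eq_bigr => mm _; rewrite -mul_scalar_mx. Qed.

Section CommutingTuple.
Variables (m : nat) (B : 'I_m -> 'M[C]_2).
Hypothesis BC : forall i j, B i *m B j = B j *m B i.

Lemma mpoly_mxD p q : mpoly_mx B (p + q) = mpoly_mx B p + mpoly_mx B q.
Proof. by rewrite !mpoly_mxE raddfD. Qed.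

Lemma mpoly_mxCE c : mpoly_mx B c%:MP = c%:M.
Proof. by rewrite mpoly_mxE mmapC. Qed.

(** Evaluation at matrices is multiplicative only because the members commute: this merges two
    ordered products of powers into one. *)
Lemma mpoly_mxM p q : mpoly_mx B (p * q) = mpoly_mx B p *m mpoly_mx B q.
Proof.
rewrite mpolyME big_allpairs mpoly_mxE raddf_sum /=.
rewrite /mpoly_mx mulmx_suml; apply: eq_bigr => m1 _.
rewrite raddf_sum /= mulmx_sumr; apply: eq_bigr => m2 _.
rewrite mmapZ mmapX -scalemxAl -scalemxAr scalerA -[RHS]mul_scalar_mx.
congr (_ *m _); rewrite /mmap1 -[RHS]/(_ * _) -prodrM_comm.
  by apply: eq_bigr => i _; rewrite mnmDE exprD.
by move=> i j _ _; apply: commrX; apply: commr_sym; apply: commrX; exact: BC.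
Qed.

Hypothesis Btrig : forall i, B i 0 1 = 0.

Lemma mulmx2E (M N : 'M[C]_2) i j : (M *m N) i j = M i 0 * N 0 j + M i 1 * N 1 j.
Proof. by rewrite mxE big_ord_recl big_ord1; congr (_ * _ + _ * _); congr (_ _ _); apply: val_inj. Qed.

Lemma trig_prod (s : seq 'I_m) (n : 'I_m -> nat) (M := \prod_(i <- s) B i ^+ n i) :
  [/\ M 0 1 = 0, M 0 0 = \prod_(i <- s) B i 0 0 ^+ n i &
      M 1 1 = \prod_(i <- s) B i 1 1 ^+ n i].
Proof.
have X i k : [/\ (B i ^+ k) 0 1 = 0, (B i ^+ k) 0 0 = B i 0 0 ^+ k & (B i ^+ k) 1 1 = B i 1 1 ^+ k].
  elim: k => [|k [e1 e2 e3]]; first by rewrite !expr0 !mxE.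
  by rewrite !exprS !mulmx2E e1 e2 e3 Btrig !mulr0 !mul0r !addr0 add0r.
rewrite /M {M}; elim: s => [|i s [e1 e2 e3]]; first by rewrite !big_nil !mxE.
have [x1 x2 x3] := X i (n i).
by rewrite !big_cons !mulmx2E e1 e2 e3 x1 x2 x3 !mulr0 !mul0r !addr0 add0r.
Qed.

Lemma mpoly_mx_trig p : [/\ mpoly_mx B p 0 1 = 0,
  mpoly_mx B p 0 0 = p.@[fun i => B i 0 0] &
  mpoly_mx B p 1 1 = p.@[fun i => B i 1 1]].
Proof.
rewrite !mevalE /mpoly_mx; split; rewrite summxE.
- by rewrite big1 // => mm _; rewrite mxE; have [-> _ _] := trig_prod (index_enum _) mm; rewrite mulr0.
- by apply: eq_bigr => mm _; rewrite mxE; have [_ -> _] := trig_prod (index_enum _) mm.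
- by apply: eq_bigr => mm _; rewrite mxE; have [_ _ ->] := trig_prod (index_enum _) mm.
Qed.
End CommutingTuple.

Lemma mpoly_mx_conj m (B : 'I_m -> 'M[C]_2) (P P' : 'M[C]_2) p : P' *m P = 1%:M ->
  mpoly_mx (fun i => P *m B i *m P') p = P *m mpoly_mx B p *m P'.
Proof.
move=> PP; have PP' : P *m P' = 1%:M by apply: mulmx1C.
have X i k : (P *m B i *m P') ^+ k = P *m (B i ^+ k) *m P'.
  elim: k => [|k IH]; first by rewrite !expr0 mulmx1.
  by rewrite !exprS IH -[LHS]/(_ *m _) !mulmxA -[_ *m P' *m P]mulmxA PP mulmx1 -!mulmxA.
rewrite /mpoly_mx mulmx_sumr mulmx_suml; apply: eq_bigr => mm _.
rewrite -scalemxAr -scalemxAl; congr (_ *: _).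
elim: (index_enum _) => [|i s IH]; first by rewrite !big_nil mulmx1.
rewrite !big_cons IH X -[LHS]/(_ *m _) -[_ * _ in RHS]/(_ *m _).
by rewrite !mulmxA -[_ *m P' *m P]mulmxA PP mulmx1.
Qed.

Lemma ip2E x y : ip2 x y = dot y x.
Proof. by apply: eq_bigr => i _; rewrite mulrC. Qed.

Lemma dot2E y x : dot y x = (y 0 0)^* * x 0 0 + (y 1 0)^* * x 1 0.
Proof.
rewrite /dot big_ord_recl big_ord1.
by have -> : lift ord0 ord0 = 1 :> 'I_2 by apply: val_inj.
Qed.

Lemma mulmx2vE (M : 'M[C]_2) (x : 'cV[C]_2) i : (M *m x) i 0 = M i 0 * x 0 0 + M i 1 * x 1 0.
Proof. by rewrite mxE big_ord_recl big_ord1; congr (_ * _ + _ * _); congr (_ _ _); apply: val_inj. Qed.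

Lemma ord2P (P : 'I_2 -> Prop) : P 0 -> P 1 -> forall i, P i.
Proof.
move=> P0 P1 i; have [->|->] // : i = 0 \/ i = 1.
by case: i => [[|[|//]] hi]; [left | right]; apply: val_inj.
Qed.

(** * Rational functional calculus of a triangular tuple *)

Section TrigTuple.
Variables (r : R) (m : nat) (T : 'I_m -> 'M[C]_2).
Hypothesis TC : forall i j, T i *m T j = T j *m T i.
Hypothesis Ttrig : forall i, T i 0 1 = 0.

Definition zero_free (q : {mpoly C[m]}) : Prop :=
  forall z : 'I_m -> C, (forall i, in_cl_annulus r (z i)) -> q.@[z] != 0.

Definition polyannulus := {z : 'I_m -> C | forall i, in_cl_annulus r (z i)}.

(** M = f(T), stated for some representation f = p/q and with the denominator cleared. As a relation
    it requires no choice of p and q, and sums and products need no inverse. *)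
Definition rat_graph (f : polyannulus -> C) (M : 'M[C]_2) : Prop :=
  exists p q, [/\ zero_free q, forall z, f z = p.@[sval z] / q.@[sval z] &
                  M *m mpoly_mx T q = mpoly_mx T p].

Hypothesis Ta : forall i, in_cl_annulus r (T i 1 1).
Hypothesis Tb : forall i, in_cl_annulus r (T i 0 0).

Definition pta : polyannulus := exist _ (fun i => T i 1 1) Ta.
Definition ptb : polyannulus := exist _ (fun i => T i 0 0) Tb.

Lemma mpoly_mx_unit q : zero_free q -> mpoly_mx T q \in unitmx.
Proof.
move=> q0; have [e1 e2 e3] := mpoly_mx_trig Ttrig q.
apply: unitmx_inj => x qx; have x0 : x 0 0 = 0.
  have := congr1 (fun y : 'cV[C]_2 => y 0 0) qx.
  rewrite mulmx2vE e1 mul0r addr0 e2 mxE => /eqP; rewrite mulf_eq0 => /orP[h|/eqP //].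
  by have := q0 _ Tb; rewrite h.
have x1 : x 1 0 = 0.
  have := congr1 (fun y : 'cV[C]_2 => y 1 0) qx.
  rewrite mulmx2vE x0 mulr0 add0r e3 mxE => /eqP; rewrite mulf_eq0 => /orP[h|/eqP //].
  by have := q0 _ Ta; rewrite h.
by apply/matrixP => i j; rewrite ord1 [RHS]mxE; move: i; apply: ord2P.
Qed.

Lemma rat_graph_trig f M : rat_graph f M ->
  [/\ M 0 1 = 0, M 0 0 = f ptb & M 1 1 = f pta].
Proof.
move=> [p [q [q0 fE MqE]]].
have [q1 q2 q3] := mpoly_mx_trig Ttrig q; have [p1 p2 p3] := mpoly_mx_trig Ttrig p.
have qa := q0 _ Ta; have qb := q0 _ Tb.
have ME i j : M i 0 * mpoly_mx T q 0 j + M i 1 * mpoly_mx T q 1 j = mpoly_mx T p i j.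
  by rewrite -mulmx2E MqE.
have M01 : M 0 1 = 0.
  have := ME 0 1; rewrite q1 p1 mulr0 add0r q3 => /eqP.
  by rewrite mulf_eq0 (negbTE qa) orbF => /eqP.
split=> //; rewrite fE /=.
  by rewrite -p2 -q2 -ME M01 mul0r addr0 mulfK // q2.
by rewrite -p3 -q3 -ME q1 mulr0 add0r mulfK // q3.
Qed.

Lemma rat_graph_cst c : rat_graph (fun=> c) c%:M.
Proof.
exists c%:MP, 1%:MP; split.
- by move=> z _; rewrite mevalC oner_eq0.
- by move=> z; rewrite !mevalC divr1.
- by rewrite !mpoly_mxCE mulmx1.
Qed.

Lemma rat_graphD f M g N : rat_graph f M -> rat_graph g N ->
  rat_graph (fun z => f z + g z) (M + N).
Proof.
move=> [p [q [q0 fE MqE]]] [p' [q' [q0' gE NqE]]].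
exists (p * q' + p' * q), (q * q'); split.
- by move=> z az; rewrite mevalM mulf_neq0 ?q0 ?q0'.
- move=> z; rewrite fE gE mevalD !mevalM.
  have h := q0 _ (svalP z); have h' := q0' _ (svalP z).
  by field; rewrite h h'.
rewrite mpoly_mxD mulmxDl !mpoly_mxM // mulmxA MqE; congr (_ + _).
by rewrite -mpoly_mxM // mulrC !mpoly_mxM // mulmxA NqE.
Qed.

Lemma rat_graphM f M g N : rat_graph f M -> rat_graph g N ->
  rat_graph (fun z => f z * g z) (M *m N).
Proof.
move=> [p [q [q0 fE MqE]]] [p' [q' [q0' gE NqE]]].
exists (p * p'), (q' * q); split.
- by move=> z az; rewrite mevalM mulf_neq0 ?q0 ?q0'.
- move=> z; rewrite fE gE !mevalM.
  have h := q0 _ (svalP z); have h' := q0' _ (svalP z).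
  by field; rewrite h h'.
rewrite !mpoly_mxM // -mulmxA [N *m _]mulmxA NqE -mpoly_mxM // mulrC mpoly_mxM //.
by rewrite mulmxA MqE.
Qed.

Lemma rat_graphV f M : (forall z, f z != 0) -> rat_graph f M ->
  exists N, rat_graph (fun z => (f z)^-1) N.
Proof.
move=> f0 [p [q [q0 fE MqE]]].
have p0 : zero_free p.
  move=> z az; have := f0 (exist _ z az); rewrite fE /=.
  by apply: contra => /eqP ->; rewrite mul0r.
exists (mpoly_mx T q *m invmx (mpoly_mx T p)), q, p; split=> //.
- by move=> z; rewrite fE invf_div.
- by rewrite mulmxKV // mpoly_mx_unit.
Qed.

Definition rat_deriv (f : polyannulus -> C) (d : C) : Prop :=
  exists2 M, rat_graph f M & d = M 1 0.

Hypothesis contr : forall f M (c : R), rat_graph f M -> 0 <= c ->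
  (forall z, normc (f z) ^+ 2 <= c) -> normc (M 1 0) ^+ 2 + normc (M 0 0) ^+ 2 <= c.

(** Positivity is used with w1 and w2 the basis vectors of indices 1 and 0. *)
Lemma rat_positivity (F : polyannulus -> 'M[C]_2) (dF : 'M[C]_2) :
  (forall i j, rat_deriv (fun z => F z i j) (dF i j)) ->
  (forall z x, 0 <= Re (dot x (F z *m x))) ->
  0 <= Re (F pta 1 1 + dF 1 0 + F ptb 0 0).
Proof.
move=> FD F0.
pose e (k : 'I_2) : 'cV[C]_2 := \col_i (i == k)%:R.
have eE (A : 'M[C]_2) k l : dot (e k) (A *m e l) = A k l.
  rewrite dot2E !mulmx2vE !mxE !conjc_nat.
  move: k l; apply: ord2P; apply: ord2P; rewrite /=; ring.
have := @positivity polyannulus pta ptb rat_deriv _ _ _ _ _ F dF (e 1) (e 0) FD F0.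
rewrite !eE; apply.
- by move=> c; exists c%:M; [exact: rat_graph_cst | rewrite !mxE].
- move=> f d g d' [M fM ->] [N gN ->]; exists (M + N); first exact: rat_graphD.
  by rewrite mxE.
- move=> f d g d' [M fM ->] [N gN ->]; exists (M *m N); first exact: rat_graphM.
  have [m1 m2 m3] := rat_graph_trig fM; have [n1 n2 n3] := rat_graph_trig gN.
  by rewrite mulmx2E -m3 -n2 addrC.
- move=> f d f0 [M fM _]; have [N gN] := rat_graphV f0 fM.
  by exists (N 1 0), N.
- move=> f d c [M fM ->] fa c0 fc; have [_ <- _] := rat_graph_trig fM.
  exact: contr fM c0 fc.
Qed.
End TrigTuple.

(** * The representing positive functional *)

Section Functional.
Variables (r : R) (m : nat) (T : 'I_m -> 'M[C]_2).
Hypothesis r01 : 0 < r < 1.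
Hypothesis TC : forall i j, T i *m T j = T j *m T i.
Hypothesis Ttrig : forall i, T i 0 1 = 0.
Hypothesis Ta : forall i, in_cl_annulus r (T i 1 1).
Hypothesis Tb : forall i, in_cl_annulus r (T i 0 0).
Hypothesis contr : forall f M (c : R), @rat_graph r m T f M -> 0 <= c ->
  (forall z, normc (f z) ^+ 2 <= c) -> normc (M 1 0) ^+ 2 + normc (M 0 0) ^+ 2 <= c.

(* A positive functional on matrix-valued functions is encoded as a scalar one: the matrix
   [A] at [z] becomes the function [(z, xi) |-> xi^* A xi] on points and unit vectors. *)
Definition bdsphere :=
  {y : ('I_m -> C) * 'cV[C]_2 | (forall i, in_bd_annulus r (y.1 i)) /\ dot y.2 y.2 = 1}.

Definition bdpoint (y : bdsphere) : polyannulus r m :=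
  exist (fun z : 'I_m -> C => forall i, in_cl_annulus r (z i)) (sval y).1
    (fun i => bd_cl_annulus r01 ((svalP y).1 i)).

Lemma bdsphere_mk (z : 'I_m -> C) (xi : 'cV[C]_2) : (forall i, in_bd_annulus r (z i)) ->
  dot xi xi = 1 -> exists y : bdsphere, (sval y).1 = z /\ (sval y).2 = xi.
Proof. by move=> bz x1; exists (exist _ (z, xi) (conj bz x1)). Qed.

Lemma bdsphere_inhabited : exists y : bdsphere, True.
Proof.
have [||y _] := @bdsphere_mk (fun=> 1) (\col_i (i == 0)%:R).
- by move=> i; rewrite in_bd_annulusE normc_real normr1 eqxx orbT.
- by rewrite dot2E !mxE !conjc_nat /=; ring.
by exists y.
Qed.

Definition bre (f : bfun bdsphere) : R := sup [set Re (f y) | y in [set: bdsphere]]%classic.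

Lemma bre_ge (f : bfun bdsphere) y : Re (f y) <= bre f.
Proof.
apply: ub_le_sup; last by exists y.
have [M hM] := bfun_bnd f; exists M => _ [z _ <-].
exact: le_trans (ler_norm _) (le_trans (normc_Re _) (hM z)).
Qed.

Lemma bre_le (f : bfun bdsphere) c : (forall y, Re (f y) <= c) -> bre f <= c.
Proof.
move=> fc; apply: ge_sup; last by move=> _ [y _ <-].
by have [y _] := bdsphere_inhabited; exists (Re (f y)), y.
Qed.

(** The value c is the sum over k, l of the (k,l) entry of rho(F_kl); the (0,1) term vanishes by
    triangularity. A relation is used because h determines F only through its form on the
    boundary. *)
Definition rat_form_graph (h : bfun bdsphere) (c : C) : Prop :=
  exists (F : polyannulus r m -> 'M[C]_2) (dF : 'M[C]_2),
    [/\ forall i j, rat_deriv T (fun z => F z i j) (dF i j),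
        forall y, h y = dot (sval y).2 (F (bdpoint y) *m (sval y).2) &
        c = F (pta Ta) 1 1 + dF 1 0 + F (ptb Tb) 0 0].

Lemma rat_deriv_eq f g d e : f =1 g -> d = e -> @rat_deriv r m T f d -> rat_deriv T g e.
Proof. by move=> /funext -> ->. Qed.

Lemma rat_derivD f d g e : rat_deriv T f d -> rat_deriv T g e ->
  @rat_deriv r m T (fun z => f z + g z) (d + e).
Proof.
move=> [M fM ->] [N gN ->]; exists (M + N); first exact: rat_graphD.
by rewrite mxE.
Qed.

Lemma rat_derivZ c f d : rat_deriv T f d -> @rat_deriv r m T (fun z => c * f z) (c * d).
Proof.
move=> [M fM ->]; exists (c%:M *m M); first exact: rat_graphM (rat_graph_cst _ _ _) fM.
by rewrite mul_scalar_mx mxE.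
Qed.

Lemma rat_deriv_cst c : @rat_deriv r m T (fun=> c) 0.
Proof. by exists c%:M; [exact: rat_graph_cst | rewrite !mxE]. Qed.

(** Positivity is applied to s - F with s = [bre h]. The constant matrix s contributes s at a and s
    at b, which is the origin of the factor 2. *)
Lemma rat_form_dominated h c : rat_form_graph h c -> Re c <= 2 * bre h.
Proof.
move=> [F [dF [FD hE ->]]]; set s := bre h.
pose F' z : 'M[C]_2 := s%:C%:M + (-1) *: F z.
have F'D i j : rat_deriv T (fun z => F' z i j) (((-1) *: dF) i j).
  apply: rat_deriv_eq (rat_derivD (rat_deriv_cst ((s%:C%:M : 'M_2) i j))
                                  (rat_derivZ (-1) (FD i j))) => [z|].
    by rewrite [RHS]mxE [X in _ = _ + X]mxE.
  by rewrite add0r [RHS]mxE.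
have F'E z x : dot x (F' z *m x) = s%:C * dot x x - dot x (F z *m x).
  by rewrite /F' mulmxDl mul_scalar_mx -scalemxAl dotDr !dotZr mulN1r.
have bd (y : bdsphere) x : 0 <= Re (dot x (F' (bdpoint y) *m x)).
  have [->|x0] := eqVneq x 0.
    by rewrite mulmx0 /dot big1 //= => i _; rewrite mxE mulr0.
  have n0 := dot_gt0 x0; set n := Re (dot x x) in n0.
  have nE : dot x x = n%:C.
    by have := dot_ge0 x; rewrite lecE /n; case: (dot x x) => a b /= /andP[/eqP -> _].
  (* The supremum [bre] sees unit vectors only, so x is rescaled to the sphere. *)
  have [k [x' [k0 x'1 xx']]] : exists k x', [/\ 0 < k, dot x' x' = 1 & x = k%:C *: x'].
    have k0 : 0 < Num.sqrt n by rewrite sqrtr_gt0.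
    have k2 : Num.sqrt n ^+ 2 = n by rewrite sqr_sqrtr // ltW.
    move: (Num.sqrt n) k0 k2 => k k0 k2; exists k, (k^-1%:C *: x); split=> //.
      rewrite dotZl dotZr conjcR nE mulrA -!rmorphM /= -k2.
      by have -> : k^-1 * k^-1 * k ^+ 2 = 1 by field; rewrite gt_eqF.
    by rewrite scalerA -rmorphM /= mulfV ?scale1r // gt_eqF.
  have [y' [y1 y2]] := bdsphere_mk (svalP y).1 x'1.
  have yy : bdpoint y' = bdpoint y.
    by apply: eq_exist; rewrite y1.
  rewrite F'E xx' dotZl dotZr -scalemxAr dotZl dotZr conjcR x'1 mulr1.
  have := bre_ge h y'; rewrite hE y2 yy -/s => hs.
  rewrite ReB !ReZ /=; nra.
(* For fixed x the form is a scalar rational function of z; the maximum principle for its negative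
   carries nonnegativity from the distinguished boundary to the whole polyannulus. *)
have all z x : 0 <= Re (dot x (F' z *m x)).
  have [d] : exists d, rat_deriv T (fun z => dot x (F' z *m x)) d.
    eexists.
    have -> : (fun z => dot x (F' z *m x)) =
       fun z => ((x 0 0)^* * x 0 0 * F' z 0 0 + (x 0 0)^* * x 1 0 * F' z 0 1)
         + ((x 1 0)^* * x 0 0 * F' z 1 0 + (x 1 0)^* * x 1 0 * F' z 1 1).
      by apply/funext => w; rewrite dot2E !mulmx2vE; ring.
    by apply: rat_derivD; apply: rat_derivD; apply: rat_derivZ; exact: F'D.
  move=> [M [p [q [q0 fE _]]] _].
  have q1 (w : 'I_m -> C) : (forall i, in_cl_annulus r (w i)) -> q.@[w] != 0 by exact: q0.
  have [w bw] := polyannulus_max_principle r01 (- p) q1 (svalP z).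
  have [|y [y1 _]] := @bdsphere_mk w (\col_i (i == 0)%:R) bw.
    by rewrite dot2E !mxE !conjc_nat /=; ring.
  have := bd y x; rewrite fE (fE z) /= y1 !mevalN !mulNr.
  by case: (_ / _) => a b /=; case: (_ / _) => a' b' /=; lra.
have := rat_positivity TC Ttrig Ta Tb contr F'D all.
rewrite !mxE /= !ReD /=.
set A := F _ 1 1; set B := F _ 0 0; rewrite !mulN1r.
by case: A => ? ? /=; case: B => ? ? /=; case: (dF 1 0) => ? ? /=; lra.
Qed.

Lemma representing_functional : exists lam : bfun bdsphere -> C,
  [/\ forall a f g, lam (a *: f + g) = a * lam f + lam g,
      forall f : bfun bdsphere, (forall y, 0 <= f y) -> 0 <= lam f &
      forall f M (u v : 'cV[C]_2) (h : bfun bdsphere), rat_graph T f M ->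
        (forall y, h y = f (bdpoint y) * dot (map_mx conjc (sval y).2) u *
                         (dot (map_mx conjc (sval y).2) v)^*) ->
        lam h = dot v (M *m u)].
Proof.
have [||||||lam [lin ext dom]] := @complex_Hahn_Banach _ (fun h => 2 * bre h) _ _ rat_form_graph.
- move=> f g; rewrite -mulrDr ler_pM2l //; apply: bre_le => y.
  change (Re (f y + g y) <= bre f + bre g); rewrite ReD.
  by apply: lerD; exact: bre_ge.
- move=> t f t0; rewrite mulrCA; congr (_ * _); apply/eqP; rewrite eq_le; apply/andP; split.
    apply: bre_le => y; change (Re (t%:C * f y) <= t * bre f).
    by rewrite ReZ ler_pM2l //; exact: bre_ge.
  rewrite -ler_pdivlMl //; apply: bre_le => y; rewrite ler_pdivlMl //.
  by have := bre_ge (t%:C *: f) y; rewrite -[(t%:C *: f) y]/(t%:C * f y) ReZ.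
- exists (fun=> 0), 0; split.
  + by move=> i j; apply: rat_deriv_eq (rat_deriv_cst 0) => [z|]; rewrite mxE.
  + by move=> y; rewrite mul0mx /dot big1 // => i _; rewrite mxE mulr0.
  + by rewrite !mxE !addr0.
- move=> f c g d [F [dF [FD fE ->]]] [G [dG [GD gE ->]]].
  exists (fun z => F z + G z), (dF + dG); split.
  + by move=> i j; apply: rat_deriv_eq (rat_derivD (FD i j) (GD i j)) => [z|];
       rewrite [RHS]mxE.
  + by move=> y; rewrite mulmxDl dotDr -fE -gE.
  + by rewrite !mxE; ring.
- move=> a f c [F [dF [FD fE ->]]].
  exists (fun z => a *: F z), (a *: dF); split.
  + by move=> i j; apply: rat_deriv_eq (rat_derivZ a (FD i j)) => [z|]; rewrite [RHS]mxE.
  + by move=> y; rewrite -scalemxAl dotZr -fE.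
  + by rewrite !mxE; ring.
- exact: rat_form_dominated.
exists lam; split=> //.
- move=> f f0.
  (* Domination by [2 * bre] turns Re (c f) <= 0 into Re (c lam f) <= 0. The values -1, i and -i of
     c show that [lam f] is real and nonnegative. *)
  have le0 c : (forall y, Re (c * f y) <= 0) -> Re (c * lam f) <= 0.
    move=> h; have := dom (c *: f + 0); rewrite lin.
    have -> : lam 0 = 0.
      by have := lin 1 0 0; rewrite scale1r addr0 mul1r => /eqP; rewrite -subr_eq0 opprD addNKr oppr_eq0 => /eqP.
    rewrite !addr0 => /le_trans; apply; rewrite pmulr_rle0 //.
    exact: bre_le.
  have fr y : exists2 t : R, 0 <= t & f y = t%:C.
    exists (Re (f y)); have := f0 y; rewrite lecE => /andP[/eqP h1 h2] //.
    by apply: complex_ext => //=; rewrite h1.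
  have h1 : Re (-1 * lam f) <= 0.
    by apply: le0 => y; have [t t0 ->] := fr y; rewrite mulN1r /= oppr_le0.
  have h2 : Re ('i%C * lam f) <= 0.
    by apply: le0 => y; have [t t0 ->] := fr y; rewrite /= !mul0r mulr0 subr0.
  have h3 : Re (- 'i%C * lam f) <= 0.
    by apply: le0 => y; have [t t0 ->] := fr y; rewrite /=; lra.
  rewrite lecE; move: h1 h2 h3; case: (lam f) => x y /= h1 h2 h3.
  by apply/andP; split; [apply/eqP | ]; lra.
- move=> f M u v h fM hE; apply: ext.
  (* The rank-one matrix with (k,l) entry u_l times the conjugate of v_k: its form factors as
     required, and the functional becomes the sum of M_kl u_l conj(v_k). *)
  exists (fun z => f z *: (\matrix_(j, i) (u i 0 * (v j 0)^*))),
    (M 1 0 *: (\matrix_(j, i) (u i 0 * (v j 0)^*))); split.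
  + move=> i j; have fD : rat_deriv T f (M 1 0) by exists M.
    by apply: rat_deriv_eq (rat_derivZ (u j 0 * (v i 0)^*) fD) => [z|]; rewrite !mxE mulrC.
  + move=> y; rewrite hE -scalemxAl dotZr -mulrA; congr (_ * _).
    rewrite !dot2E !mulmx2vE !mxE conjcD !conjcM !conjcK.
    by ring.
  + have [m1 m2 m3] := rat_graph_trig Ttrig Ta Tb fM.
    by rewrite dot2E !mulmx2vE !mxE m1 m2 m3; ring.
Qed.
End Functional.

(** * Doubly commuting contractions *)

Lemma adjmxE (A : 'M[C]_2) i j : adjmx A i j = (A j i)^*.
Proof. by rewrite !mxE. Qed.

Lemma adjmxM (A B : 'M[C]_2) : adjmx (A *m B) = adjmx B *m adjmx A.
Proof. by rewrite /adjmx map_mxM trmx_mul. Qed.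

Lemma unitary_trigonalization m (B : 'I_m -> 'M[C]_2) :
  (forall i j, B i *m B j = B j *m B i) ->
  exists P, P *m adjmx P = 1%:M /\ forall i, (P *m B i *m adjmx P) 0 1 = 0.
Proof.
move=> BC.
have [|P PU /allP Ptrig] := @cotrigonalization C 2 [seq B i | i <- enum 'I_m].
  by move=> _ _ /mapP[i _ ->] /mapP[j _ ->]; exact: BC.
have adjE : (P ^t Num.conj)%sesqui = adjmx P by apply/matrixP => i j; rewrite !mxE.
exists P; split; first by rewrite -adjE; exact/unitarymxP.
move=> i; have /Ptrig : B i \in [seq B i | i <- enum 'I_m] by rewrite map_f ?mem_enum.
by rewrite /= /similar_to conjymx // -adjE => /is_trig_mxP/(_ 0 1); apply.
Qed.

Section DoublyCommuting.
Variables (r : R) (m : nat) (B : 'I_m -> 'M[C]_2) (P : 'M[C]_2).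
Hypothesis r01 : 0 < r < 1.
Hypothesis dcB : doubly_commuting B.
Hypothesis cB : forall i, Ar_contraction_mx r (B i).
Hypothesis PU : P *m adjmx P = 1%:M.

Let Q := adjmx P.
Let T i := P *m B i *m Q.
Hypothesis Ttrig : forall i, T i 0 1 = 0.

Lemma unitary_mulVl : Q *m P = 1%:M. Proof. exact: mulmx1C. Qed.

Lemma dot_adjmx_unitary u v : dot (Q *m u) (Q *m v) = dot u v.
Proof. by rewrite dot_adj adjmxK mulmxA PU mul1mx. Qed.

Lemma conj_tuple_comm i j : T i *m T j = T j *m T i.
Proof.
have E k l : T k *m T l = P *m (B k *m B l) *m Q.
  by rewrite /T !mulmxA -[_ *m Q *m P]mulmxA unitary_mulVl mulmx1.
by rewrite !E dcB.1.
Qed.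

(** A diagonal entry of the triangular matrix [T i] is an eigenvalue of [T i], hence of the
    unitarily equivalent [B i]. *)
Lemma conj_tuple_diag_annulus i k : in_cl_annulus r (T i k k).
Proof.
apply: (cB i).1; rewrite unitmxE unitfE negbK.
set l := T i k k.
have <- : \det (T i - l%:M) = \det (B i - l%:M).
  have -> : T i - l%:M = P *m (B i - l%:M) *m Q.
    by rewrite mulmxBr mulmxBl mul_mx_scalar -scalemxAl PU scalemx1.
  by rewrite !det_mulmx mulrAC -det_mulmx PU det1 mul1r.
have subE (A : 'M[C]_2) a b : (A - l%:M) a b = A a b - l *+ (a == b) by rewrite !mxE.
rewrite det_trig; last first.
  apply/is_trig_mxP; apply: ord2P; apply: ord2P => // _.
  by rewrite subE Ttrig subr0.
by rewrite (bigD1 k) //= subE eqxx subrr mul0r.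
Qed.

Lemma conj_tuple_doubly i j : i != j -> T i *m adjmx (T j) = adjmx (T j) *m T i.
Proof.
move=> ij; rewrite /T !adjmxM adjmxK.
have E (A A' : 'M[C]_2) : P *m A *m Q *m (P *m (A' *m Q)) = P *m (A *m A') *m Q.
  by rewrite !mulmxA -[_ *m Q *m P]mulmxA unitary_mulVl mulmx1.
have E' (A A' : 'M[C]_2) : P *m (A' *m Q) *m (P *m A *m Q) = P *m (A' *m A) *m Q.
  by rewrite !mulmxA -[_ *m Q *m P]mulmxA unitary_mulVl mulmx1.
by rewrite E E' dcB.2.
Qed.

(* A tuple with a non-normal member [T k] consists of scalars elsewhere, because the members
   commute with [T k] and [adjmx (T k)], which generate all of 'M_2. *)
Lemma doubly_commuting_dichotomy : (forall i, T i 1 0 = 0) \/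
  exists k, forall i, i != k -> T i = (T i 1 1)%:M.
Proof.
have [Td|nTd] := pselect (forall i, T i 1 0 = 0); first by left.
have [k /eqP tk] : exists k, T k 1 0 <> 0 by apply/existsNP.
right; exists k => i ik.
have E a b : T i a 0 * (T k b 0)^* + T i a 1 * (T k b 1)^* =
    (T k 0 a)^* * T i 0 b + (T k 1 a)^* * T i 1 b.
  by rewrite -!adjmxE -!mulmx2E conj_tuple_doubly.
have ti : T i 1 0 = 0.
  have := E 0 0; rewrite !Ttrig mul0r addr0 mulrC => /eqP.
  rewrite eq_sym addrC -subr_eq0 addrK mulf_eq0 conjc_eq0 (negbTE tk) /=.
  by move/eqP.
have ba : T i 0 0 = T i 1 1.
  have := E 0 1; rewrite !Ttrig mul0r addr0 mulr0 add0r mulrC.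
  by apply: mulfI; rewrite conjc_eq0.
apply/matrixP => a b; move: a b; apply: ord2P; apply: ord2P;
by rewrite [RHS]mxE ?ti ?ba ?Ttrig //= ?mulr1n.
Qed.

Lemma mpoly_mx_conj_tuple p : mpoly_mx T p = P *m mpoly_mx B p *m Q.
Proof. exact: mpoly_mx_conj unitary_mulVl. Qed.

(** If all members are diagonal, the corner is 0 and [M 0 0] is a value of f. Otherwise f(B) is a
    rational function of one contraction [B k], whose denominator is zero-free because the scalars
    lie in the annulus. *)
Lemma conj_tuple_contractive f M (c : R) : @rat_graph r m T f M -> 0 <= c ->
  (forall z, normc (f z) ^+ 2 <= c) -> normc (M 1 0) ^+ 2 + normc (M 0 0) ^+ 2 <= c.
Proof.
move=> fM c0 fc.
have Ta i : in_cl_annulus r (T i 1 1) by exact: conj_tuple_diag_annulus.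
have Tb i : in_cl_annulus r (T i 0 0) by exact: conj_tuple_diag_annulus.
have [_ M00 _] := rat_graph_trig Ttrig Ta Tb fM.
have [p [q [q0 fE MqE]]] := fM.
have [Td|[k Tk]] := doubly_commuting_dichotomy.
  have d0 (s : {mpoly C[m]}) : mpoly_mx T s 1 0 = 0.
    rewrite /mpoly_mx summxE big1 // => mm _; rewrite mxE.
    suff -> : (\prod_i T i ^+ mm i) 1 0 = 0 by rewrite mulr0.
    have mul0 (M1 M2 : 'M[C]_2) : M1 1 0 = 0 -> M2 1 0 = 0 -> (M1 * M2) 1 0 = 0.
      by move=> h1 h2; rewrite mulmx2E h1 h2 mul0r mulr0 addr0.
    apply: (big_ind (fun M1 : 'M[C]_2 => M1 1 0 = 0)) => [|//|i _]; first by rewrite mxE.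
    elim: (mm i) => [|n IH]; first by rewrite expr0 mxE.
    by rewrite exprS; exact: mul0.
  have := congr1 (fun A : 'M[C]_2 => A 1 0) MqE; rewrite mulmx2E !d0 mulr0 addr0.
  have [_ -> _] := mpoly_mx_trig Ttrig q.
  move=> /eqP; rewrite mulf_eq0 (negbTE (q0 _ Tb)) orbF => /eqP ->.
  by rewrite normc0 expr0n add0r M00.
pose w i := T i 1 1.
have Bk i : i != k -> B i = (w i)%:M.
  move=> ik; have -> : B i = Q *m T i *m P.
    by rewrite /T !mulmxA unitary_mulVl mul1mx -mulmxA unitary_mulVl mulmx1.
  by rewrite (Tk i ik) mul_mx_scalar -scalemxAl unitary_mulVl scalemx1.
have awk x : in_cl_annulus r x -> forall i, in_cl_annulus r (if i == k then x else w i).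
  by move=> ax i; case: ifP => // _; exact: Ta.
have qs z : in_cl_annulus r z -> (slice w k q).[z] != 0.
  by move=> az; rewrite slice_horner; apply: q0; exact: awk.
have bnd z : in_cl_annulus r z ->
    `|(slice w k p).[z] / (slice w k q).[z]| <= (Num.sqrt c)%:C.
  move=> az; rewrite !slice_horner normC_normc lecR.
  have := fc (exist _ _ (awk z az)); rewrite fE /= => h.
  rewrite -(ler_pXn2r (n := 2)) ?nnegrE ?normc_ge0 ?sqrtr_ge0 //.
  by rewrite sqr_sqrtr //; exact: h.
have := (cB k).2 _ _ qs _ bnd.
rewrite /opnorm_le /rat_eval_mx -!(slice_mx _ Bk).
have BqU : mpoly_mx B q \in unitmx.
  have := mpoly_mx_unit Ttrig Ta Tb q0; rewrite mpoly_mx_conj_tuple !unitmx_mul.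
  by case/andP => /andP[].
have NE : mpoly_mx B p *m invmx (mpoly_mx B q) = Q *m M *m P.
  have <- : Q *m (M *m (P *m mpoly_mx B q *m Q)) *m P *m invmx (mpoly_mx B q) = Q *m M *m P.
    by rewrite !mulmxA -[_ *m Q *m P]mulmxA unitary_mulVl mulmx1 mulmxK.
  by rewrite -mpoly_mx_conj_tuple MqE mpoly_mx_conj_tuple !mulmxA unitary_mulVl mul1mx -[_ *m Q *m P]mulmxA unitary_mulVl mulmx1.
(* The test vector Q e_0 isolates the first column of M; the unitary Q preserves its length. *)
move=> /(_ (Q *m \col_i (i == 0)%:R)); rewrite NE !ip2E.
rewrite -!mulmxA [P *m (Q *m _)]mulmxA PU mul1mx !dot_adjmx_unitary.
rewrite -rmorphXn sqr_sqrtr // !dot2E !mulmx2vE !mxE !conjc_nat /=.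
rewrite !mulr1 !mulr0 !addr0 ![_^* * _]mulrC !mulc_conj -rmorphD -[X in _ <= X]rmorphM lecR.
by rewrite mulr1 addrC.
Qed.
End DoublyCommuting.

(** * The dilation on the GNS space *)

Theorem mainTheorem15 (r : R) (m : nat) (B : 'I_m -> 'M[C]_2) :
  0 < r < 1 ->
  doubly_commuting B ->
  (forall i, Ar_contraction_mx r (B i)) ->
  exists (K : lmodType C) (ip : K -> K -> C) (V : 'cV[C]_2 -> K)
         (U : 'I_m -> K -> K),
    [/\ is_hilbert ip,
        isometric_embedding ip V,
        (forall i j, U i \o U j =1 U j \o U i),
        (forall i, Ar_unitary r ip (U i)) &
        forall p q : {mpoly C[m]},
          (forall z : 'I_m -> C, (forall i, in_cl_annulus r (z i)) -> q.@[z] != 0) ->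
          mpoly_mx B q \in unitmx /\
          exists W : K -> K,
            [/\ bounded_op ip W,
                mpoly_op U q \o W =1 id,
                W \o mpoly_op U q =1 id &
                forall x y : 'cV[C]_2,
                  ip (mpoly_op U p (W (V x))) (V y)
                  = ip2 (mpoly_mx B p *m invmx (mpoly_mx B q) *m x) y]].
Proof.
move=> r01 dcB cB.
have [P [PU Ttrig]] := unitary_trigonalization dcB.1.
pose T i := P *m B i *m adjmx P.
have TC := conj_tuple_comm dcB PU : forall i j, T i *m T j = T j *m T i.
have Ta i : in_cl_annulus r (T i 1 1) by exact: conj_tuple_diag_annulus.
have Tb i : in_cl_annulus r (T i 0 0) by exact: conj_tuple_diag_annulus.
have unitary_mulVl : adjmx P *m P = 1%:M by exact: mulmx1C.
have dotP u v : dot (P *m u) (P *m v) = dot u v.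
  by rewrite dot_adj mulmxA unitary_mulVl mul1mx.
have [lam [lin pos rep]] := representing_functional r01 TC Ttrig Ta Tb
  (conj_tuple_contractive dcB cB PU Ttrig).
pose Y := bdsphere r m.
have ybd (y : Y) i : in_bd_annulus r ((sval y).1 i) by have [] := svalP y.
have ysph (y : Y) : normc ((sval y).2 0 0) ^+ 2 + normc ((sval y).2 1 0) ^+ 2 = 1.
  have [_] := svalP y; rewrite dot2E ![_^* * _]mulrC !mulc_conj -rmorphD.
  by case.
have zP i : (fun y : Y => (sval y).1 i) \in @bounded_pred Y.
  apply/asboolP; exists 1 => y.
  by have := bd_cl_annulus r01 (ybd y i); rewrite in_cl_annulusE => /andP[].
pose z i : bfun Y := Bfun (zP i).
(* As [dot] conjugates its first argument, this function is xi |-> sum_i xi_i u_i. *)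
have vP u : (fun y : Y => dot (map_mx conjc (sval y).2) u) \in @bounded_pred Y.
  apply/asboolP; exists (normc (u 0 0) + normc (u 1 0)) => y.
  rewrite dot2E !mxE !conjcK; apply: le_trans (normcD _ _) _; rewrite !normcM.
  have := ysph y; have := normc_ge0 ((sval y).2 0 0); have := normc_ge0 ((sval y).2 1 0).
  move: (normc _) (normc ((sval y).2 0 0)) => a b a0 b0 ab.
  have a1 : a <= 1 by nra.
  have b1 : b <= 1 by nra.
  by apply: lerD; rewrite ler_piMl ?normc_ge0.
pose v u : bfun Y := Bfun (vP u).
pose H := gns_inner lin pos.
have vD a u u' : v (a *: u + u') = a *: v u + v u'.
  by apply: bfun_ext => y; rewrite bfunZD /= dotDr dotZr.
exists (gns lin pos), (@cip _ H), (fun x => embed H (v (P *m x))), (fun i => @mulop _ lam lin pos (z i)).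
split.
- exact: completion_hilbert.
- split=> [a x y|x y].
    by rewrite mulmxDr -scalemxAr vD embed_lin.
  rewrite -[embed H (v (P *m x))]mulop1 cip_mulop ip2E.
  rewrite (rep (fun=> 1) 1%:M (P *m x) (P *m y)); first by rewrite mul1mx dotP.
    exact: rat_graph_cst.
  by move=> t; rewrite -mulrA.
- by move=> i j phi /=; exact: mulopC.
- move=> i; split; first exact: mulop_normal.
  move=> l; rewrite in_bd_annulusE negb_or => /andP[l1 l2].
  (* A lower bound for the distance from l to the two boundary circles; it makes 1/(z_i - l) bounded
     by 1/d on the boundary. *)
  pose d := Num.min `|normc l - r| `|normc l - 1|.
  have d0 : 0 < d by rewrite lt_min !normr_gt0 !subr_eq0 l1.
  have zl (y : Y) : d <= normc (z i y - l).
    have h : `|normc l - normc (z i y)| <= normc (z i y - l).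
      have := normcD (z i y) (l - z i y); have := normcD l (z i y - l).
      rewrite ![_ + (_ - _)]addrC !subrK (normcB l) ler_norml => h1 h2.
      by apply/andP; split; lra.
    apply: le_trans h; rewrite ge_min; have := ybd y i; rewrite in_bd_annulusE.
    by case/orP => /eqP ->; rewrite lexx ?orbT.
  have wP : (fun y : Y => (z i y - l)^-1) \in @bounded_pred Y.
    apply/asboolP; exists d^-1 => y; rewrite normcV lef_pV2 ?posrE //.
    exact: lt_le_trans d0 (zl y).
  have wz y : Bfun wP y * ((- l) *: bcst Y 1 + z i) y = 1.
    rewrite bfunZD /= mulr1 addrC [- l + _]addrC mulVf //.
    by rewrite -normc_gt0; exact: lt_le_trans d0 (zl y).
  have opE phi : @mulop _ lam lin pos (z i) phi - l *: phi =
      @mulop _ lam lin pos ((- l) *: bcst Y 1 + z i) phi.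
    by rewrite mulop_lin mulop1 scaleNr addrC.
  have [e1 e2] := mulop_inverse lin pos wz.
  exists (@mulop _ lam lin pos (Bfun wP)); split; first exact: mulop_bounded.
  + by move=> phi /=; rewrite opE; exact: e1.
  + by move=> phi /=; rewrite opE; exact: e2.
move=> p q q0.
have TqU : mpoly_mx T q \in unitmx by exact: (@mpoly_mx_unit r m T Ttrig Ta Tb q q0).
have TE s : mpoly_mx T s = P *m mpoly_mx B s *m adjmx P by exact: mpoly_mx_conj.
have BqU : mpoly_mx B q \in unitmx.
  by move: TqU; rewrite TE !unitmx_mul => /andP[/andP[]].
split=> //.
have [d d0 qd] := meval_lower_bound q0.
have qY (y : Y) : beval z q y = q.@[(sval y).1] by rewrite bevalE; exact: meval_eq.
have clY (y : Y) i : in_cl_annulus r ((sval y).1 i) by exact: bd_cl_annulus (ybd y i).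
(* The inverse of q(U) is multiplication by 1/q. *)
have wP : (fun y : Y => (beval z q y)^-1) \in @bounded_pred Y.
  apply/asboolP; exists d^-1 => y; rewrite normcV qY.
  by rewrite lef_pV2 ?posrE ?qd // (lt_le_trans d0) // qd.
have wq y : Bfun wP y * beval z q y = 1.
  by rewrite /= mulVf // qY q0.
have [e1 e2] := mulop_inverse lin pos wq.
exists (@mulop _ lam lin pos (Bfun wP)); split.
- exact: mulop_bounded.
- by move=> phi /=; rewrite -mulop_beval; exact: e1.
- by move=> phi /=; rewrite -mulop_beval; exact: e2.
move=> x y; rewrite -mulop_beval -mulopM cip_mulop ip2E.
pose M := mpoly_mx T p *m invmx (mpoly_mx T q).
pose f (t : polyannulus r m) := p.@[sval t] / q.@[sval t].
have fM : rat_graph T f M by exists p, q; split=> //; rewrite mulmxKV.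
rewrite (rep f M (P *m x) (P *m y) _ fM); last first.
  move=> t; rewrite -mulrA; congr (_ * _).
  by rewrite /= bevalE bevalE.
(* Back to the original basis: rho(f) P = P f(B), and P preserves inner products. *)
have -> : M *m (P *m x) = P *m (mpoly_mx B p *m invmx (mpoly_mx B q) *m x).
  have e : M *m P = P *m (mpoly_mx B p *m invmx (mpoly_mx B q)).
    have TqV : invmx (mpoly_mx T q) = P *m invmx (mpoly_mx B q) *m adjmx P.
      apply: (can_inj (mulKmx TqU)); rewrite mulmxV // TE !mulmxA.
      by rewrite -[_ *m adjmx P *m P]mulmxA unitary_mulVl mulmx1 mulmxK // PU.
    by rewrite /M TqV TE !mulmxA -[_ *m adjmx P *m P]mulmxA unitary_mulVl mulmx1
       -[_ *m adjmx P *m P]mulmxA unitary_mulVl mulmx1.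
  by rewrite mulmxA e -!mulmxA.
by rewrite dotP.
Qed.
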